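(* Let $(E,v)$ be a Henselian valued field, let $f=\sum_{i=0}^n a_iX^i\in E[X]$ be a polynomial with $n\ge 1$ and $a_0a_n\neq0$, and let $f'=\sum_{i=0}^n\widetilde{a_i}X^i\in GE[X]$. Then, for $\lambda$ in the divisible hull of $\Gamma_E$: (1) If $f$ is a $\lambda$-polynomial and $f=gh$ in $E[X]$, then $g$ and $h$ are $\lambda$-polynomials and $\widetilde{f}^{(\lambda)}=\widetilde{g}^{(\lambda)}\widetilde{h}^{(\lambda)}$ in $GE[X]$. So, if $\widetilde{f}^{(\lambda)}$ is irreducible in $GE[X]$, then $f$ is irreducible in $E[X]$. (2) If $f$ is irreducible in $E[X]$, then $f$ is a $\lambda$-polynomial for $\lambda=\frac1n(v(a_0)-v(a_n))$. Furthermore, $\widetilde{f}^{(\lambda)}=\widetilde{a_n}k^s$ for some irreducible monic homogeneous polynomial $k$ of $GE[X]^{(\lambda)}$ and some positive integer $s$. (3) If $f$ is a $\lambda$-polynomial in $E[X]$ and $\widetilde{f}^{(\lambda)}=\ell m$ in $GE[X]$ with $\gcd(\ell,m)=1$, then there exist $\lambda$-polynomials $g,h$ in $E[X]$ such that $f=gh$, $\widetilde{g}^{(\lambda)}=\ell$ and $\widetilde{h}^{(\lambda)}=m$. (4) If $f$ is a $\lambda$-polynomial and $\widetilde{f}^{(\lambda)}$ has a simple root $b$ in $GE$, then $f$ has a simple root $a$ in $E$ with $\widetilde{a}=b$. (5) Suppose $f'$ is a $\lambda$-homogenizable polynomial of $GE[X]$. Then $f$ is a $\lambda$-polynomial and 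$\widetilde{f}^{(\lambda)}=f'$.
   Context: For a valued field $(E,v)$ with value group $\Gamma_E$ and $\gamma\in\Gamma_E$, put $E^{\gamma}=\{x: v(x)\ge\gamma\}$, $E^{>\gamma}=\{x: v(x)>\gamma\}$, $GE_\gamma=E^\gamma/E^{>\gamma}$. For $x\neq0$, $\widetilde{x}=x+E^{>v(x)}\in GE_{v(x)}$, and $\widetilde0=0$. $GE=\bigoplus_\gamma GE_\gamma$ with multiplication $\widetilde{x}\,\widetilde{y}=\widetilde{xy}$ is the associated graded field (a commutative graded integral domain in which all nonzero homogeneous elements are invertible). For $\lambda$ in the divisible hull of $\Gamma_E$, $GE[X]^{(\lambda)}$ is $GE[X]$ with the unique grading extending that of $GE$ for which $X$ is homogeneous of grade $\lambda$; a polynomial in $GE[X]$ is $\lambda$-homogenizable if it is homogeneous in $GE[X]^{(\lambda)}$. A polynomial $f=\sum_{i=0}^na_iX^i\in E[X]$ with $a_0a_n\ne0$, $n\ge1$, is a $\lambda$-polynomial if $\lambda=\frac1n(v(a_0)-v(a_n))$ and for every extension of $v$ to an algebraic closure of $E$ all roots of $f$ have value $\lambda$; equivalently $v(a_i)\ge(n-i)\lambda+v(a_n)$ for all $i$. For such $f$, $\widetilde{f}^{(\lambda)}=\sum_{i=0}^n\overline{a_i}^{(\lambda)}X^i\in GE[X]$, where $\overline{a_i}^{(\lambda)}=\widetilde{a_i}$ if $v(a_i)=(n-i)\lambda+v(a_n)$ and $\overline{a_i}^{(\lambda)}=0$ if $v(a_i)>(n-i)\lambda+v(a_n)$. A nonzero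 constant polynomial $c$ is regarded as a $\lambda$-polynomial for every $\lambda$, with $\widetilde{c}^{(\lambda)}$ the constant polynomial $\widetilde c$. Here $\gcd(\ell,m)=1$ means that $\ell,m$ have no common nonunit divisor in $GE[X]$. *)

(* Defs.v *)
From HB Require Import structures.
From mathcomp Require Import all_boot all_order all_algebra.
From mathcomp Require Import boolp.

Set Implicit Arguments.
Unset Strict Implicit.
Unset Printing Implicit Defensive.

Import Order.TTheory GRing.Theory.
Local Open Scope ring_scope.
Local Open Scope quotient_scope.

(* MathComp's [porderZmodType] imposes no compatibility between the order and
   the addition. *)
HB.mixin Record POrderedZmodule_isOAG D of Num.POrderedZmodule D := {
  oag_total : forall x y : D, (x <= y) || (y <= x);
  oag_lerD2r : forall z x y : D, x <= y -> x + z <= y + z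
}.

#[short(type="oagType")]
HB.structure Definition OAG :=
  { D of Num.POrderedZmodule D & POrderedZmodule_isOAG D }.

Section OAGTheory.
Variable D : oagType.
Implicit Types x y z t : D.

Lemma oag_lerD2 z x y : (x + z <= y + z) = (x <= y).
Proof.
apply/idP/idP; last exact: oag_lerD2r.
by move=> /(oag_lerD2r (- z)); rewrite !addrK.
Qed.

Lemma oag_ltrD2 z x y : (x + z < y + z) = (x < y).
Proof. by rewrite !lt_neqAle oag_lerD2 (inj_eq (addIr z)). Qed.

Lemma oag_lerD x y z t : x <= y -> z <= t -> x + z <= y + t.
Proof.
move=> xy zt; apply: (@le_trans _ _ (y + z)); first by rewrite oag_lerD2.
by rewrite ![y + _]addrC oag_lerD2.
Qed.

Lemma oag_ltr_leD x y z t : x < y -> z <= t -> x + z < y + t.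
Proof.
move=> xy zt; apply: (@lt_le_trans _ _ (y + z)); first by rewrite oag_ltrD2.
by rewrite ![y + _]addrC oag_lerD2.
Qed.

Lemma oag_double_eq0 x : x + x = 0 -> x = 0.
Proof.
move=> xx; case: (comparable_ltgtP (oag_total x 0)) => // x0.
  by have := oag_ltr_leD x0 (ltW x0); rewrite xx addr0 ltxx.
by have := oag_ltr_leD x0 (ltW x0); rewrite xx addr0 ltxx.
Qed.

End OAGTheory.

(* A valuation is only meaningful on nonzero elements: the value at 0, which
   should be +oo, is left unspecified, and every use below guards it.  The
   group D may be larger than the value group (see [divisible_hull]). *)
Record valuation (D : oagType) (E : fieldType) := Valuation {
  val_fun :> E -> D;
  valuationM : forall x y, x != 0 -> y != 0 ->
    val_fun (x * y) = val_fun x + val_fun y;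
  valuationD : forall x y, x != 0 -> y != 0 -> x + y != 0 ->
    Order.min (val_fun x) (val_fun y) <= val_fun (x + y)
}.

Section Valuation.
Variables (D : oagType) (E : fieldType) (v : valuation D E).
Implicit Types (x y : E) (g h d : D).

Definition value_group d : Prop := exists2 x : E, x != 0 & v x = d.

(* D is the divisible hull of the value group of v, the latter being
   regarded as a subgroup of D (D is torsion-free since it is ordered). *)
Definition divisible_hull : Prop :=
  (forall d (n : nat), (0 < n)%N -> exists e : D, e *+ n = d) /\
  (forall d, exists2 n : nat, (0 < n)%N & value_group (d *+ n)).

(* E^g = {x | v x >= g} and E^{>g} = {x | v x > g}; both contain 0. *)
Definition vge g x : bool := (x == 0) || (g <= v x).
Definition vgt g x : bool := (x == 0) || (g < v x).

Lemma valuation1 : v 1 = 0.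
Proof.
have := valuationM v (oner_neq0 E) (oner_neq0 E).
by rewrite mulr1 => /(congr1 (fun z => z - v 1)); rewrite addrK subrr => <-.
Qed.

Lemma valuationN x : v (- x) = v x.
Proof.
have [->|x0] := eqVneq x 0; first by rewrite oppr0.
have N0 : (-1 : E) != 0 by rewrite oppr_eq0 oner_eq0.
have vN1 : v (-1) = 0.
  apply: oag_double_eq0; rewrite -valuationM //.
  by rewrite mulrNN mulr1 valuation1.
by rewrite -mulN1r valuationM // vN1 add0r.
Qed.

Lemma vge0 g : vge g 0. Proof. by rewrite /vge eqxx. Qed.
Lemma vgt0 g : vgt g 0. Proof. by rewrite /vgt eqxx. Qed.

Lemma vgeN g x : vge g (- x) = vge g x.
Proof. by rewrite /vge oppr_eq0 valuationN. Qed.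

Lemma vgtN g x : vgt g (- x) = vgt g x.
Proof. by rewrite /vgt oppr_eq0 valuationN. Qed.

Lemma vgtW g x : vgt g x -> vge g x.
Proof. by rewrite /vgt /vge; case: (x == 0) => //=; apply: ltW. Qed.

Lemma vgeD g x y : vge g x -> vge g y -> vge g (x + y).
Proof.
rewrite /vge; have [->|x0] := eqVneq x 0; first by rewrite add0r.
have [->|y0 /= gx gy] := eqVneq y 0; first by rewrite addr0 (negPf x0).
have [//|xy0 /=] := eqVneq (x + y) 0.
by apply: le_trans (valuationD v x0 y0 xy0); rewrite (comparable_le_min _ (oag_total _ _)) gx.
Qed.

Lemma vgtD g x y : vgt g x -> vgt g y -> vgt g (x + y).
Proof.
rewrite /vgt; have [->|x0] := eqVneq x 0; first by rewrite add0r.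
have [->|y0 /= gx gy] := eqVneq y 0; first by rewrite addr0 (negPf x0).
have [//|xy0 /=] := eqVneq (x + y) 0.
by apply: lt_le_trans (valuationD v x0 y0 xy0); rewrite (comparable_lt_min _ (oag_total _ _)) gx.
Qed.

Lemma vgeM g h x y : vge g x -> vge h y -> vge (g + h) (x * y).
Proof.
rewrite /vge mulf_eq0; have [//|x0] := eqVneq x 0.
have [//|y0 /= gx gy] := eqVneq y 0.
by rewrite valuationM // oag_lerD.
Qed.

Lemma vgtM g h x y : vge g x -> vgt h y -> vgt (g + h) (x * y).
Proof.
rewrite /vge /vgt mulf_eq0; have [//|x0] := eqVneq x 0.
have [//|y0 /= gx gy] := eqVneq y 0.
by rewrite valuationM // addrC (addrC (v x)) oag_ltr_leD.
Qed.

Lemma vge_val x : vge (v x) x. Proof. by rewrite /vge lexx orbT. Qed.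

(* GE = \bigoplus_g E^g / E^{>g} is built as a quotient of the finite formal
   sums of pairs (g, x) with x in E^g, such a pair standing for the class
   x + E^{>g}.  Two formal sums are identified when, for every grade g, the
   sums of their terms of grade g agree modulo E^{>g}.  Grades range over all
   of D, but GE_g = 0 unless g is in the value group. *)
Definition gterm := {p : D * E | vge p.1 p.2}.

Definition grade (t : gterm) : D := (val t).1.
Definition gcoef (t : gterm) : E := (val t).2.

Lemma gtermP (t : gterm) : vge (grade t) (gcoef t).
Proof. exact: (valP t). Qed.

Definition gterm_opp (t : gterm) : gterm :=
  Sub (grade t, - gcoef t) (etrans (vgeN _ _) (gtermP t)).

Definition gterm_mul (s t : gterm) : gterm :=
  Sub (grade s + grade t, gcoef s * gcoef t) (vgeM (gtermP s) (gtermP t)).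

Lemma vge01 : vge (0, 1 : E).1 (0 : D, 1 : E).2.
Proof. by rewrite /vge /= valuation1 lexx orbT. Qed.

Definition gterm_one : gterm := Sub (0, 1) vge01.

Implicit Types (s t u : seq gterm).

Definition gcomp s g : E := \sum_(a <- s | grade a == g) gcoef a.

Definition gsum_eqv s t : bool :=
  `[< forall g, vgt g (gcomp s g - gcomp t g) >].

Lemma gsum_eqv_equiv : equiv_class_of gsum_eqv.
Proof.
split.
- by move=> s; apply/asboolP => g; rewrite subrr vgt0.
- move=> s t; apply/asboolP/asboolP => st g.
    by rewrite -opprB vgtN.
  by rewrite -opprB vgtN.
- move=> t s u /asboolP st /asboolP tu; apply/asboolP => g.
  by rewrite -(subrK (gcomp t g) (gcomp s g)) -addrA vgtD.
Qed.

Canonical gsum_equiv := EquivRelPack gsum_eqv_equiv.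

Definition graded := {eq_quot gsum_equiv}.

HB.instance Definition _ := Choice.on graded.
HB.instance Definition _ := EqQuotient.on graded.

Lemma gradedP s t :
  reflect (forall g, vgt g (gcomp s g - gcomp t g))
          (\pi_graded s == \pi_graded t).
Proof. by rewrite eqmodE; apply: (iffP (asboolP _)). Qed.

Lemma graded_eq s t : (forall g, gcomp s g = gcomp t g) ->
  \pi_graded s = \pi_graded t.
Proof. by move=> st; apply/eqP/gradedP => g; rewrite st subrr vgt0. Qed.

Lemma gcomp_repr s g : vgt g (gcomp (repr (\pi_graded s)) g - gcomp s g).
Proof. by move: g; apply/gradedP; rewrite reprK. Qed.

Lemma gcomp_vge s g : vge g (gcomp s g).
Proof.
rewrite /gcomp; elim/big_rec: _ => [|a x /eqP <- ?]; first exact: vge0.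
by rewrite vgeD ?gtermP.
Qed.

Lemma gcomp_nil g : gcomp [::] g = 0. Proof. exact: big_nil. Qed.

Lemma gcomp_cat s t g : gcomp (s ++ t) g = gcomp s g + gcomp t g.
Proof. exact: big_cat. Qed.

Definition gsum_opp s := map gterm_opp s.

Lemma gcomp_opp s g : gcomp (gsum_opp s) g = - gcomp s g.
Proof. by rewrite /gcomp big_map -sumrN. Qed.

Definition gsum_mul s t := [seq gterm_mul a b | a <- s, b <- t].

Lemma gcomp_mull s t g :
  gcomp (gsum_mul s t) g = \sum_(a <- s) gcoef a * gcomp t (g - grade a).
Proof.
rewrite /gcomp big_mkcond big_allpairs_dep /=; apply: eq_bigr => a _.
rewrite mulr_sumr [RHS]big_mkcond /=; apply: eq_bigr => b _.
by rewrite /grade /gcoef /= [in RHS]eq_sym subr_eq eq_sym addrC.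
Qed.

Lemma gcomp_mulC s t g : gcomp (gsum_mul s t) g = gcomp (gsum_mul t s) g.
Proof.
rewrite /gcomp big_mkcond big_allpairs_dep /= exchange_big /=.
rewrite [RHS]big_mkcond big_allpairs_dep /=.
apply: eq_bigr => b _; apply: eq_bigr => a _.
by rewrite /grade /gcoef /= addrC mulrC.
Qed.

Lemma gsum_mulr s t u : (forall g, vgt g (gcomp t g - gcomp u g)) ->
  forall g, vgt g (gcomp (gsum_mul s t) g - gcomp (gsum_mul s u) g).
Proof.
move=> tu g; rewrite !gcomp_mull -sumrB.
elim/big_rec: _ => [|a x _ xg]; first exact: vgt0.
rewrite vgtD // -mulrBr -[X in vgt X _](subrK (grade a)) addrC.
by rewrite vgtM // gtermP.
Qed.

Definition graded_zero : graded := \pi_graded [::].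
Definition graded_one : graded := \pi_graded [:: gterm_one].
Definition graded_add (a b : graded) : graded := \pi_graded (repr a ++ repr b).
Definition graded_opp (a : graded) : graded := \pi_graded (gsum_opp (repr a)).
Definition graded_mul (a b : graded) : graded :=
  \pi_graded (gsum_mul (repr a) (repr b)).

Lemma graded_addE s t : graded_add (\pi_graded s) (\pi_graded t) = \pi_graded (s ++ t).
Proof.
apply/eqP/gradedP => g; rewrite !gcomp_cat opprD addrACA.
by rewrite vgtD // gcomp_repr.
Qed.

Lemma graded_oppE s : graded_opp (\pi_graded s) = \pi_graded (gsum_opp s).
Proof.
by apply/eqP/gradedP => g; rewrite !gcomp_opp -opprD vgtN gcomp_repr.
Qed.

Lemma graded_mulE s t : graded_mul (\pi_graded s) (\pi_graded t) = \pi_graded (gsum_mul s t).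
Proof.
apply/eqP/gradedP => g.
rewrite -(subrK (gcomp (gsum_mul (repr (\pi_graded s)) t) g) (gcomp _ g)) -addrA.
rewrite vgtD //; first by apply: gsum_mulr => h; rewrite gcomp_repr.
rewrite gcomp_mulC [X in _ - X]gcomp_mulC.
by apply: gsum_mulr => h; rewrite gcomp_repr.
Qed.

Lemma graded_addA : associative graded_add.
Proof.
move=> a b c; rewrite -[a]reprK -[b]reprK -[c]reprK.
move: (repr a) (repr b) (repr c) => s t u.
by rewrite (graded_addE t u) (graded_addE s t) !graded_addE catA.
Qed.

Lemma graded_addC : commutative graded_add.
Proof.
move=> a b; rewrite -[a]reprK -[b]reprK;
move: (repr a) (repr b) => s t; rewrite (graded_addE s t) (graded_addE t s).
by apply: graded_eq => g; rewrite !gcomp_cat addrC.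
Qed.

Lemma graded_add0 : left_id graded_zero graded_add.
Proof. by move=> a; rewrite -[a]reprK graded_addE. Qed.

Lemma graded_addN : left_inverse graded_zero graded_opp graded_add.
Proof.
move=> a; rewrite -[a]reprK; move: (repr a) => s; rewrite (graded_oppE s) graded_addE.
by apply: graded_eq => g; rewrite gcomp_cat gcomp_opp addNr gcomp_nil.
Qed.

HB.instance Definition _ := GRing.isZmodule.Build graded
  graded_addA graded_addC graded_add0 graded_addN.

Lemma graded_mulA : associative graded_mul.
Proof.
move=> a b c; rewrite -[a]reprK -[b]reprK -[c]reprK.
move: (repr a) (repr b) (repr c) => s t u.
rewrite (graded_mulE t u) (graded_mulE s t) !graded_mulE.
apply: graded_eq => g; rewrite [RHS]gcomp_mull [LHS]gcomp_mull big_allpairs_dep /=.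
apply: eq_bigr => x _; rewrite gcomp_mull mulr_sumr; apply: eq_bigr => y _.
by rewrite /grade /gcoef /= mulrA opprD addrA.
Qed.

Lemma graded_mulC : commutative graded_mul.
Proof.
move=> a b; rewrite -[a]reprK -[b]reprK;
move: (repr a) (repr b) => s t; rewrite (graded_mulE s t) (graded_mulE t s).
by apply: graded_eq => g; rewrite gcomp_mulC.
Qed.

Lemma graded_mul1 : left_id graded_one graded_mul.
Proof.
move=> a; rewrite -[a]reprK; move: (repr a) => s; rewrite graded_mulE; apply: graded_eq => g.
by rewrite gcomp_mull big_seq1 /grade /gcoef /= mul1r subr0.
Qed.

Lemma graded_mulDl : left_distributive graded_mul graded_add.
Proof.
move=> a b c; rewrite -[a]reprK -[b]reprK -[c]reprK.
move: (repr a) (repr b) (repr c) => s t u.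
rewrite (graded_addE s t) (graded_mulE s u) (graded_mulE t u).
rewrite graded_mulE graded_addE; apply: graded_eq => g.
by rewrite gcomp_cat !gcomp_mull big_cat.
Qed.

Lemma graded_oner_neq0 : graded_one != graded_zero.
Proof.
apply/gradedP => /(_ 0); rewrite gcomp_nil subr0 /gcomp big_seq_cond big_mkcond.
rewrite big_seq1 mem_seq1 eqxx /grade /gcoef /= eqxx.
by rewrite /vgt oner_eq0 valuation1 ltxx.
Qed.

HB.instance Definition _ := GRing.Zmodule_isComNzRing.Build graded
  graded_mulA graded_mulC graded_mul1 graded_mulDl graded_oner_neq0.

Definition gclass_repr g x : seq gterm :=
  if insub (g, x) is Some a then [:: a] else [::].

(* [gclass g x] is the class x + E^{>g} in GE_g for x in E^g, and 0 if
   x is not in E^g. *)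
Definition gclass g x : graded :=
  \pi_graded (gclass_repr g x).

Lemma gclass_reprE g x (gx : vge g x) :
  gclass_repr g x = [:: Sub (g, x) (gx : vge (g, x).1 (g, x).2)].
Proof.
rewrite /gclass_repr; case: insubP => [a _ a_gx|]; last by rewrite gx.
by congr (_ :: _); apply: val_inj.
Qed.

Lemma gcomp_gclass_repr g x h :
  vge g x -> gcomp (gclass_repr g x) h = if h == g then x else 0.
Proof.
move=> gx; rewrite gclass_reprE /gcomp big_mkcond big_seq1.
by rewrite /grade /gcoef /= eq_sym.
Qed.

Lemma gclassD g x y : vge g x -> vge g y ->
  gclass g (x + y) = gclass g x + gclass g y.
Proof.
move=> gx gy; rewrite [RHS]graded_addE; apply: graded_eq => h.
rewrite gcomp_cat !gcomp_gclass_repr ?vgeD //.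
by case: ifP; rewrite ?addr0.
Qed.

Lemma gclassM g h x y : vge g x -> vge h y ->
  gclass g x * gclass h y = gclass (g + h) (x * y).
Proof.
move=> gx hy; rewrite [LHS]graded_mulE; apply: graded_eq => k.
rewrite (gcomp_gclass_repr _ (vgeM gx hy)) gcomp_mull.
rewrite gclass_reprE big_seq1 /grade /gcoef /=.
rewrite (gcomp_gclass_repr _ hy) subr_eq addrC.
by case: ifP; rewrite ?mulr0.
Qed.

Lemma gclass1 : gclass 0 1 = 1.
Proof.
apply: graded_eq => g; rewrite gcomp_gclass_repr ?(vge01 : vge 0 1) //.
by rewrite /gcomp big_mkcond big_seq1 /grade /gcoef /= eq_sym.
Qed.

Lemma gclass_eq0 g x : vge g x -> (gclass g x == 0) = vgt g x.
Proof.
move=> gx; apply/gradedP/idP => [/(_ g)|xg h].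
  by rewrite gcomp_nil subr0 (gcomp_gclass_repr _ gx) eqxx.
rewrite gcomp_nil subr0 (gcomp_gclass_repr _ gx).
by case: eqP => [->|_]; rewrite ?vgt0.
Qed.

Lemma pi_sum (I : Type) (r : seq I) (F : I -> seq gterm) :
  \sum_(i <- r) (\pi_graded (F i)) = \pi_graded (flatten (map F r)).
Proof.
elim: r => [|i r IHr]; first by rewrite big_nil.
by rewrite big_cons IHr [LHS]graded_addE.
Qed.

Lemma graded_decomp (a : graded) :
  exists s : seq gterm, a = \sum_(t <- s) gclass (grade t) (gcoef t).
Proof.
exists (repr a); rewrite pi_sum -[LHS]reprK; congr (\pi_graded _).
elim: (repr a) => //= t s {1}->.
case: t => [[g x] gx]; rewrite /grade /gcoef /= gclass_reprE /=; congr (_ :: _).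
Qed.

Lemma graded_direct (r : seq D) (x : D -> E) : uniq r ->
  (forall g, g \in r -> vge g (x g)) ->
  \sum_(g <- r) gclass g (x g) = 0 ->
  forall g, g \in r -> gclass g (x g) = 0.
Proof.
move=> r_uniq rx; rewrite pi_sum => /eqP/gradedP r0 g gr.
apply/eqP; rewrite gclass_eq0 ?rx //; move: (r0 g); rewrite gcomp_nil subr0.
congr vgt; rewrite /gcomp big_flatten big_map (bigD1_seq g) //=.
rewrite [X in X + _](gcomp_gclass_repr _ (rx g gr)) eqxx.
rewrite big_seq_cond big1 ?addr0 // => h /andP[hr hg].
by rewrite [LHS](gcomp_gclass_repr _ (rx h hr)) eq_sym (negPf hg).
Qed.

Definition homogeneous_of g (a : graded) : Prop :=
  exists2 x, vge g x & a = gclass g x.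

Definition tilde x : graded := if x == 0 then 0 else gclass (v x) x.

Lemma tildeM x y : tilde x * tilde y = tilde (x * y).
Proof.
rewrite /tilde mulf_eq0; have [->|x0] := eqVneq x 0; first by rewrite mul0r.
have [->|y0] := eqVneq y 0; first by rewrite mulr0.
by rewrite gclassM ?vge_val // valuationM.
Qed.

End Valuation.

Definition algebraic_ext (E K : fieldType) (i : E -> K) : Prop :=
  forall x : K, algebraicOver i x.

Definition extends (D : oagType) (E K : fieldType) (i : E -> K)
    (v : valuation D E) (w : valuation D K) : Prop :=
  forall x, x != 0 -> w (i x) = v x.

(* When D is the divisible hull of the value group of v, an extension of v to
   an algebraic extension K of E has its value group in D (up to a unique
   isomorphism over the value group of v).  Equivalent extensions are then
   equal as functions from K \ {0} to D, so that a unique extension is one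
   that is unique as a D-valued function. *)
Definition henselian (D : oagType) (E : fieldType) (v : valuation D E) : Prop :=
  forall (K : fieldType) (i : {rmorphism E -> K}), algebraic_ext i ->
    exists2 w : valuation D K, extends i v w &
      forall w' : valuation D K, extends i v w' ->
        forall x, x != 0 -> w' x = w x.

Section ComRing.
Variable R : comNzRingType.

Definition ring_unit (a : R) : Prop := exists b, a * b = 1.

Definition ring_divides (a b : R) : Prop := exists c, b = a * c.

(* The library's [irreducible_poly] is about divisibility up to scalars of
   the coefficient ring, hence not adapted to GE[X]. *)
Definition ring_irreducible (a : R) : Prop :=
  [/\ a != 0, ~ ring_unit a &
      forall b c, a = b * c -> ring_unit b \/ ring_unit c].

Definition ring_coprime (a b : R) : Prop :=
  forall d, ring_divides d a -> ring_divides d b -> ring_unit d.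

Definition simple_root (p : {poly R}) (a : R) : Prop :=
  exists2 q : {poly R}, p = q * ('X - a%:P) & ~~ root q a.

End ComRing.

Section LambdaPoly.
Variables (D : oagType) (E : fieldType) (v : valuation D E) (lam : D).

(* p is homogeneous of grade d when X has grade lam. *)
Definition homogeneous_poly_of (d : D) (p : {poly graded v}) : Prop :=
  forall i, homogeneous_of (d - lam *+ i) p`_i.

Definition homogenizable (p : {poly graded v}) : Prop :=
  exists d, homogeneous_poly_of d p.

(* The equation on lam says lam = (v a_0 - v a_n) / n, as D is torsion-free. *)
Definition lambda_poly (f : {poly E}) : Prop :=
  size f = 1%N \/
  let n := (size f).-1 in
  [/\ (0 < n)%N, f`_0 != 0, lam *+ n = v f`_0 - v f`_n &
      forall (K : closedFieldType) (i : {rmorphism E -> K}),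
        algebraic_ext i ->
        forall w : valuation D K, extends i v w ->
        forall r : K, root (map_poly i f) r -> w r = lam].

(* Meaningful for lam-polynomials, where v a_i >= lam *+ (n - i) + v a_n
   whenever a_i != 0. *)
Definition tilde_poly (f : {poly E}) : {poly graded v} :=
  let n := (size f).-1 in
  \poly_(i < size f)
    (if (f`_i != 0) && (v f`_i == lam *+ (n - i) + v f`_n)
     then tilde v f`_i else 0).

End LambdaPoly.

(* Main.v *)
Require Import Defs.
From HB Require Import structures.
From mathcomp Require Import all_boot all_order all_algebra.
From mathcomp Require Import all_field.
From mathcomp Require Import finmap boolp classical_sets filter.

Set Implicit Arguments.
Unset Strict Implicit.
Unset Printing Implicit Defensive.

Import Order.TTheory GRing.Theory.
Local Open Scope ring_scope.

(** A polynomial [P] is called [bounded] in grade [d] when [v P`_i >= d - i lam]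
    for all [i]; its initial form in grade [d] is then the polynomial over GE
    whose [i]-th coefficient is the class of [P`_i] in grade [d - i lam].  Initial
    forms are multiplicative, compatible with evaluation, and are exactly the
    homogeneous polynomials of [GE[X]^(lam)].  A polynomial all of whose roots
    have value [lam] is one whose Newton polygon is a single segment of slope
    [lam] ([slope_poly], [lambda_polyP]); its [tilde_poly] is its initial form in
    the grade [v f`_0].  Passing from roots to coefficients requires a valued
    algebraic closure, obtained as the field of algebraic elements of an
    ultraproduct of splitting fields.  Part (1) is then the multiplicativity of
    initial forms, and part (5) is read off the coefficients.

    The heart of the matter is (2).  Let [p] be irreducible and [z] be its root in
    [L = E[X]/(p)].  A root [r] of [p] in any valued extension of [E] induces a
    valuation on [L]; as there is only one, [P.[r]] and [P.[z]] have the same value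
    for every [P] ([exists_root_field]).  In particular all roots of [p] have the
    same value [lam].  Among the monic homogeneous polynomials over GE that vanish
    at the class of [z] in grade [lam], let [k] be one of least degree.  Euclidean
    division of lifts shows that [k] divides every homogeneous polynomial that
    vanishes there, so that [k] is irreducible, and prime with respect to
    homogeneous polynomials ([key_prime], [key_irreducible]).  Write the initial
    form of [p] as [k ^ s m] with [k] not dividing [m], and lift [m] to [M].  If [M]
    had a root [rho], then [p.[rho]], a product of the [rho - r], would have too
    large a value, so that [rho] would have the same class as some root [r] of [p];
    [m] would then vanish at the class of [r], hence at the class of [z], and be
    divisible by [k].  Thus [m = 1] ([irreducible_initial_form]).

    For (3), the two factors of a homogeneous polynomial are homogeneous, because
    their highest and lowest components multiply to those of the product
    ([homogeneous_factors]).  Each irreducible factor of [f] has, up to a unit, a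
    prime power as its initial form, which divides exactly one of the two coprime
    factors; this tells to which of [g] and [h] it belongs ([slope_hensel]).  Part (4) is the
    case where one factor is ['X - b]. *)

(** * Polynomials over rings and fields *)

Lemma exists_minimal (P : nat -> Prop) : (exists n, P n) ->
  exists n, P n /\ forall m, P m -> (n <= m)%N.
Proof.
move=> [n Pn]; have exP : exists n, `[< P n >] by exists n; apply/asboolP.
case: (ex_minnP exP) => m /asboolP Pm mP; exists m; split=> // m' Pm'.
by apply: mP; apply/asboolP.
Qed.

Lemma monic_not_unit (R : comNzRingType) (k : {poly R}) :
  k \is monic -> (1 < size k)%N -> ~ ring_unit k.
Proof.
move=> mon_k k1 [b kb]; have b0 : b != 0.
  by apply/eqP => b0; move/eqP: kb; rewrite b0 mulr0 eq_sym oner_eq0.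
have := congr1 (fun q : {poly R} => size q) kb; rewrite size_monicM // size_poly1.
case: (size k) k1 => // -[|m] // _; rewrite -size_poly_gt0 in b0.
by case: (size b) b0 => // m' _; rewrite addnS.
Qed.

Lemma monic_mulI (R : comNzRingType) (k a b : {poly R}) :
  k \is monic -> k * a = k * b -> a = b.
Proof. by move=> /monic_lreg; apply. Qed.

(** Dividing by [k] as often as possible stops because the degree drops. *)
Lemma monic_multiplicity (R : comNzRingType) (k p : {poly R}) :
  k \is monic -> (1 < size k)%N -> p != 0 ->
  exists s m, p = k ^+ s * m /\ ~ ring_divides k m.
Proof.
move=> mon_k k1; have [n] := ubnP (size p); elim: n p => // n IHn p pn p0.
have [[c pE]|not_kp] := pselect (ring_divides k p); last first.
  by exists 0, p; rewrite mul1r.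
have c0 : c != 0 by apply: contraNneq p0 => c0; rewrite pE c0 mulr0.
have [|s [m [cE km]]] := IHn c _ c0.
  rewrite -ltnS (leq_trans _ pn) // pE size_monicM //.
  by case: (size k) k1 => // -[|j] // _; rewrite !addSn /= ltnS ltnS leq_addl.
by exists s.+1, m; rewrite pE cE exprS mulrA.
Qed.

Lemma ring_coprime_sym (R : comNzRingType) (a b : R) :
  ring_coprime a b -> ring_coprime b a.
Proof. by move=> ab d db da; apply: ab. Qed.

Lemma irreducible_polyZ (E : fieldType) c (p : {poly E}) : c != 0 ->
  irreducible_poly p -> irreducible_poly (c *: p).
Proof.
move=> c0 [p1 irr_p]; split=> [|q q1]; first by rewrite size_scale.
rewrite dvdpZr // => /(irr_p q q1) /eqp_trans; apply.
by rewrite eqp_sym eqp_scale.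
Qed.

(** By Bezout: a polynomial not divisible by the irreducible [p] is coprime to
    [p], hence has no common root with it in any extension. *)
Lemma irreducible_root_dvdp (E K : fieldType) (i : {rmorphism E -> K})
    (p q : {poly E}) r : irreducible_poly p -> root (map_poly i p) r ->
  root (map_poly i q) r = (p %| q).
Proof.
move=> irr_p pr; apply/idP/idP => [qr|/dvdpP[s ->]]; last first.
  by rewrite rmorphM rootM pr orbT.
rewrite -[_ %| _]negbK -irreducible_poly_coprime //; apply/negP.
by rewrite -(coprimep_map i) => /coprimep_root/(_ pr); rewrite -/(root _ _) qr.
Qed.

(** Strong induction on the degree, deciding irreducibility classically. *)
Lemma exists_irreducible_factor (F : fieldType) (p : {poly F}) :
  (1 < size p)%N -> exists q r, p = q * r /\ irreducible_poly q.
Proof.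
have [m] := ubnP (size p); elim: m => // m IHm in p *; rewrite ltnS => pm p1.
have [irr_p|] := pselect (irreducible_poly p).
  by exists p, 1; rewrite mulr1.
have p0 : p != 0 by rewrite -size_poly_gt0 ltnW.
move=> not_irr; have [q [q1 qp pq]] :
    exists q : {poly F}, [/\ size q != 1, q %| p & ~~ (q %= p)].
  apply: contrapT => no_q; apply: not_irr; split=> // q q1 qp.
  by apply: contrapT => /negP pq; apply: no_q; exists q.
have q0 : q != 0 by apply: contraTneq qp => ->; rewrite dvd0p.
have ltqp : (size q < size p)%N.
  by rewrite ltn_neqAle dvdp_leq // andbT; apply: contraNneq pq => /eqP;
     rewrite dvdp_size_eqp.
have [|r [t [qrt irr_r]]] := IHm q (leq_trans ltqp pm).
  by rewrite ltn_neqAle eq_sym q1 size_poly_gt0.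
exists r, (t * (p %/ q)); split=> //.
by rewrite mulrA -qrt mulrC divpK.
Qed.

(** * Existence of algebraic closures *)

Definition splits (F : fieldType) (p : {poly F}) : Prop :=
  exists rs : seq F, p = lead_coef p *: \prod_(r <- rs) ('X - r%:P).

(** Adjoin one root of an irreducible factor, divide by the linear factor and
    iterate. *)
Lemma exists_splitting_field (F : fieldType) (p : {poly F}) : p != 0 ->
  exists (L : fieldType) (i : {rmorphism F -> L}), splits (map_poly i p).
Proof.
have [m] := ubnP (size p); elim: m => // m IHm in F p *; rewrite ltnS => pm p0.
have [p1|p1] := leqP (size p) 1.
  exists F, idfun; exists [::]; rewrite map_poly_id // big_nil.
  by rewrite (size1_polyC p1) lead_coefC alg_polyC.
have [q [r [pqr irr_q]]] := exists_irreducible_factor p1.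
have [L _ [z qz _]] := irredp_FAdjoin irr_q.
pose j : {rmorphism F -> L} := in_alg L.
have : root (map_poly j p) z by rewrite pqr rmorphM rootM qz.
case/factor_theorem => p' pE.
have jp0 : map_poly j p != 0 by rewrite map_poly_eq0.
have p'0 : p' != 0 by apply: contraNneq jp0 => p'0; rewrite pE p'0 mul0r.
have sz_p' : (size p' < m)%N.
  have := size_map_poly j p; rewrite pE size_Mmonic ?monicXsubC // size_XsubC.
  by rewrite addn2 /= => sz; rewrite sz.
have [L' [i [rs p'E]]] := IHm _ _ sz_p' p'0.
exists L', (i \o j), (i z :: rs).
rewrite map_poly_comp pE rmorphM /= lead_coefM.
rewrite map_polyXsubC lead_coefXsubC mulr1 big_cons [in LHS]p'E.
by rewrite -scalerAl mulrC.
Qed.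

Section UltraProduct.
Variables (T : pointedType) (L : T -> fieldType).

(** An alias for the dependent product, to carry the pointwise ring structure;
    the index type is pointed so that [1] differs from [0]. *)
Definition field_product := forall t, L t.
HB.instance Definition _ := gen_eqMixin field_product.
HB.instance Definition _ := gen_choiceMixin field_product.
Implicit Types x y z : field_product.

Let zero : field_product := fun=> 0.
Let one : field_product := fun=> 1.
Let opp x : field_product := fun t => - x t.
Let add x y : field_product := fun t => x t + y t.
Let mul x y : field_product := fun t => x t * y t.

Fact product_addA : associative add.
Proof. by move=> x y z; apply: functional_extensionality_dep => t;
  rewrite /add addrA. Qed.
Fact product_addC : commutative add.
Proof. by move=> x y; apply: functional_extensionality_dep => t;
  rewrite /add addrC. Qed.
Fact product_add0 : left_id zero add.
Proof. by move=> x; apply: functional_extensionality_dep => t;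
  rewrite /add add0r. Qed.
Fact product_addN : left_inverse zero opp add.
Proof. by move=> x; apply: functional_extensionality_dep => t;
  rewrite /add addNr. Qed.
HB.instance Definition _ := GRing.isZmodule.Build field_product
  product_addA product_addC product_add0 product_addN.

Fact product_mulA : associative mul.
Proof. by move=> x y z; apply: functional_extensionality_dep => t;
  rewrite /mul mulrA. Qed.
Fact product_mulC : commutative mul.
Proof. by move=> x y; apply: functional_extensionality_dep => t;
  rewrite /mul mulrC. Qed.
Fact product_mul1 : left_id one mul.
Proof. by move=> x; apply: functional_extensionality_dep => t;
  rewrite /mul mul1r. Qed.
Fact product_mulDl : left_distributive mul add.
Proof. by move=> x y z; apply: functional_extensionality_dep => t;
  rewrite /mul /add mulrDl. Qed.
Fact product_one_neq0 : one != zero.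
Proof.
by apply/eqP => /(congr1 (@^~ point)) /eqP; rewrite oner_eq0.
Qed.
HB.instance Definition _ := GRing.Zmodule_isComNzRing.Build field_product
  product_mulA product_mulC product_mul1 product_mulDl product_one_neq0.

Definition coord t x : L t := x t.
Fact coord_is_zmod_morphism t : zmod_morphism (coord t). Proof. by []. Qed.
Fact coord_is_monoid_morphism t : monoid_morphism (coord t). Proof. by []. Qed.
HB.instance Definition _ t :=
  GRing.isZmodMorphism.Build field_product (L t) (coord t)
    (coord_is_zmod_morphism t).
HB.instance Definition _ t :=
  GRing.isMonoidMorphism.Build field_product (L t) (coord t)
    (coord_is_monoid_morphism t).

Variables (U : set_system T) (ultraU : UltraFilter U).

Definition null : {pred field_product} :=
  fun x => `[< U [set t | x t = 0]%classic >].

Lemma nullP x : reflect (U [set t | x t = 0]%classic) (x \in null).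
Proof. exact: asboolP. Qed.

Fact null_idealr_closed : idealr_closed null.
Proof.
split.
- by apply/nullP; apply: filterS filterT.
- apply/nullP => U1; apply: (@filter_not_empty _ U).
  by apply: filterS U1 => t /= /eqP; rewrite oner_eq0.
- move=> a x y /nullP x0 /nullP y0; apply/nullP.
  apply: filterS (filterI x0 y0) => t /= [xt yt].
  by rewrite -[LHS]/(a t * x t + y t) xt yt mulr0 addr0.
Qed.
HB.instance Definition _ := isIdealr.Build field_product null null_idealr_closed.

Definition ultraproduct := {ideal_quot null}.
HB.instance Definition _ := GRing.ComNzRing.on ultraproduct.
HB.instance Definition _ := EqQuotient.on ultraproduct.

Lemma ultraproduct_eqP x y :
  reflect (U [set t | x t = y t]%classic) (x == y %[mod ultraproduct])%qT.
Proof.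
rewrite -Quotient.idealrBE; apply: (iffP (nullP _)); apply: filterS => t /=.
  by move/eqP; rewrite subr_eq0 => /eqP.
by move=> xy; rewrite -[LHS]/(x t - y t) xy subrr.
Qed.

Let inv (a : ultraproduct) : ultraproduct :=
  if a == 0 then 0 else
  \pi_ultraproduct%qT ((fun t => (repr a t)^-1) : field_product).

Fact ultraproduct_mulV a : a != 0 -> inv a * a = 1.
Proof.
move=> a0; rewrite /inv (negPf a0) -[a in _ * a]reprK -rmorphM.
rewrite -(rmorph1 (\pi_ultraproduct)%qT); apply/eqP/ultraproduct_eqP.
have [U0|] := @in_ultra_setVsetC T U [set t | repr a t = 0]%classic _; last first.
  by apply: filterS => t /= /eqP at0; apply: mulVf.
case/negP: a0; rewrite -[a]reprK -(rmorph0 (\pi_ultraproduct)%qT).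
by apply/ultraproduct_eqP.
Qed.
Fact ultraproduct_inv0 : inv 0 = 0. Proof. by rewrite /inv eqxx. Qed.
HB.instance Definition _ := GRing.ComNzRing_isField.Build ultraproduct
  ultraproduct_mulV ultraproduct_inv0.

(** Two families that agree on a set of the ultrafilter get the same image. The
    quotient is a field: a family either vanishes on a large set or has a
    pointwise inverse on one. *)
Lemma exists_ultraproduct : exists (K : fieldType)
  (h : {rmorphism field_product -> K}),
  forall x y, U [set t | x t = y t]%classic -> h x = h y.
Proof.
exists ultraproduct, (\pi_ultraproduct)%qT => x y xy.
by apply/eqP/ultraproduct_eqP.
Qed.
End UltraProduct.
Arguments exists_ultraproduct {T L U}.

Lemma dvdp_splits (F : fieldType) (p q : {poly F}) :
  p %| q -> q != 0 -> splits q -> splits p.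
Proof.
move=> pq q0 [rs qE]; move: pq.
rewrite qE dvdpZr ?lead_coef_eq0 // => /dvdp_prod_XsubC[m].
case/eqpP => [[a b] /= /andP[a0 b0] pE]; exists (mask m rs).
have -> : p = (a^-1 * b) *: \prod_(i <- mask m rs) ('X - i%:P).
  by rewrite -scalerA -pE scalerA mulVf ?scale1r.
by rewrite lead_coefZ (monicP (monic_prod_XsubC _ _ _)) mulr1.
Qed.

Section AlgebraicClosure.
Variable E : fieldType.
Local Notation T := {fset {poly E}}.
Local Open Scope fset_scope.

(** The sets of indices above a given finite set form a filter base; any
    ultrafilter that refines it sees each polynomial as eventually present. *)
Lemma exists_cofinal_ultrafilter : exists2 U : set_system T, UltraFilter U &
  forall (p : {poly E}) (A : set T), (forall s : T, p \in s -> A s) -> U A.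
Proof.
pose F : set_system T :=
  fun A => exists s0 : T, forall s, s0 `<=` s -> A s.
have [] := @ultraFilterLemma T F.
  split; first by move=> [s0 /(_ s0 (fsubset_refl _))].
  split; first by exists fset0.
    move=> A B [s sA] [t tB]; exists (s `|` t) => u.
    by rewrite fsubUset => /andP[/sA ? /tB ?].
  by move=> A B AB [s sA]; exists s => t /sA /AB.
move=> U [ultraU FU]; exists U => // p A pA.
by apply: FU; exists [fset p] => s; rewrite fsub1set; apply: pA.
Qed.

(** The ultraproduct, over the finite sets [s] of polynomials, of fields [L s]
    that split all members of [s]. A fixed [p] splits in [L s] for every [s]
    containing it, that is, for almost all [s]; the families made of the [j]-th
    roots of [p] in the [L s] then give the roots in the ultraproduct. *)
Lemma exists_universal_splitting_field :
  exists (K : fieldType) (i : {rmorphism E -> K}),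
    forall p : {poly E}, p != 0 -> splits (map_poly i p).
Proof.
have [U ultraU cofU] := exists_cofinal_ultrafilter.
have /choice[LI LI_splits] : forall s : T,
    exists LI : {L : fieldType & {rmorphism E -> L}},
      splits (map_poly (projT2 LI) (\prod_(p <- s | p != 0) p)).
  move=> s; have [|L [i Li]] :=
    @exists_splitting_field E (\prod_(p <- s | p != 0) p).
    by rewrite prodf_seq_neq0; apply/allP => p _; apply/implyP.
  by exists (existT _ L i).
pose L s := projT1 (LI s); pose i s : {rmorphism E -> L s} := projT2 (LI s).
have L_splits (s : T) (p : {poly E}) : p \in s -> p != 0 ->
  splits (map_poly (i s) p).
  move=> ps p0; apply: dvdp_splits (LI_splits s).
    by rewrite dvdp_map (big_rem p ps) /= p0 dvdp_mulr.
  by rewrite map_poly_eq0 prodf_seq_neq0; apply/allP => q _; apply/implyP.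
have [K [h hE]] := exists_ultraproduct (L := L) ultraU.
pose diag a : field_product L := fun s => i s a.
have diagB : zmod_morphism diag.
  by move=> a b; apply: functional_extensionality_dep => s; apply: rmorphB.
have diagM : monoid_morphism diag.
  by split=> [|a b]; apply: functional_extensionality_dep => s;
    [apply: rmorph1 | apply: rmorphM].
pose diagR := HB.pack_for {rmorphism E -> field_product L} diag
  (GRing.isZmodMorphism.Build _ _ diag diagB)
  (GRing.isMonoidMorphism.Build _ _ diag diagM).
exists K, (h \o diagR) => p p0.
(* Choose the roots of p in L s when p belongs to s, and nothing otherwise. *)
have root_list s : exists rs : seq (L s), p \in s ->
    map_poly (i s) p = i s (lead_coef p) *: \prod_(r <- rs) ('X - r%:P).
  have [ps|_] := boolP (p \in s); last by exists nil.
  have [rs pE] := L_splits s p ps p0; exists rs => _.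
  by rewrite [LHS]pE lead_coef_map.
have [rs rsP] : exists rs : forall s, seq (L s), forall s, p \in s ->
    map_poly (i s) p = i s (lead_coef p) *: \prod_(r <- rs s) ('X - r%:P).
  by exists (fun s => projT1 (cid (root_list s))) => s; case: cid.
set n := (size p).-1.
have sz_rs (s : T) : p \in s -> size (rs s) = n.
  move=> /rsP/(congr1 (fun q : {poly L s} => size q)).
  rewrite size_map_poly size_scale ?fmorph_eq0 ?lead_coef_eq0 //.
  by rewrite size_prod_XsubC /n => ->.
pose r j : field_product L := fun s => (rs s)`_j.
exists [seq h (r j) | j <- index_iota 0 n].
pose q := \prod_(0 <= j < n) ('X - (r j)%:P).
rewrite lead_coef_map big_map.
have -> : \prod_(0 <= j < n) ('X - (h (r j))%:P) = map_poly h q.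
  by rewrite map_prod_XsubC.
(* Compare coefficients, at the indices s that contain p. *)
rewrite map_poly_comp.
rewrite -[X in X *: _]/(h (diagR (lead_coef p))) -linearZ; apply/polyP => k;
  rewrite !coef_map.
apply: hE; apply: (cofU p) => s ps.
change (coord s (diagR p`_k) = coord s (diagR (lead_coef p) *: q)`_k).
have -> : coord s (diagR p`_k) = (map_poly (i s) p)`_k by rewrite coef_map.
rewrite (rsP s ps); transitivity (map_poly (coord s) (diagR (lead_coef p) *: q))`_k.
  rewrite map_polyZ /=; congr ((_ : {poly L s})`_k); congr (_ *: _);
    by rewrite map_prod_XsubC (big_nth 0) sz_rs.
by rewrite coef_map.
Qed.

Section AlgebraicElements.
Variables (K : fieldType) (i : {rmorphism E -> K}).

Definition algebraic_in : {pred K} := fun x => `[< algebraicOver i x >].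

Lemma algebraic_inP x : reflect (algebraicOver i x) (x \in algebraic_in).
Proof. exact: asboolP. Qed.

Fact algebraic_in_divring_closed : divring_closed algebraic_in.
Proof.
split=> [|x y /algebraic_inP xA /algebraic_inP yA|x y /algebraic_inP xA
  /algebraic_inP yA].
- exact/algebraic_inP/algebraic1.
- exact/algebraic_inP/algebraic_sub.
- exact/algebraic_inP/algebraic_div.
Qed.
HB.instance Definition _ := GRing.isDivringClosed.Build K algebraic_in
  algebraic_in_divring_closed.

(** The relative algebraic closure of the image of [E] in [K]. *)
Record algebraics := Algebraics {
  algebraics_val :> K;
  algebraics_valP : algebraics_val \in algebraic_in }.

HB.instance Definition _ := [isSub for algebraics_val].
HB.instance Definition _ := [Choice of algebraics by <:].
HB.instance Definition _ := [SubChoice_isSubIntegralDomain of algebraics by <:].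
HB.instance Definition _ := [SubIntegralDomain_isSubField of algebraics by <:].

Definition to_algebraics (a : E) : algebraics :=
  Algebraics (introT (algebraic_inP _) (algebraic_id i a)).
Fact to_algebraics_is_zmod_morphism : zmod_morphism to_algebraics.
Proof. by move=> a b; apply: val_inj; rewrite /= rmorphB. Qed.
Fact to_algebraics_is_monoid_morphism : monoid_morphism to_algebraics.
Proof. by split=> [|a b]; apply: val_inj; rewrite /= ?rmorph1 ?rmorphM. Qed.
HB.instance Definition _ := GRing.isZmodMorphism.Build E algebraics to_algebraics
  to_algebraics_is_zmod_morphism.
HB.instance Definition _ := GRing.isMonoidMorphism.Build E algebraics
  to_algebraics to_algebraics_is_monoid_morphism.

Lemma algebraics_algebraic : algebraic_ext to_algebraics.
Proof.
move=> x; have /algebraic_inP[p p0 px] := algebraics_valP x; exists p => //.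
rewrite -(fmorph_root (val : algebraics -> K)).
by rewrite -map_poly_comp (eq_map_poly (g := i)).
Qed.

Hypothesis i_splits : forall p : {poly E}, p != 0 -> splits (map_poly i p).

(** A root [z], in some extension, of a polynomial over the algebraic elements
    is algebraic over [E]; the polynomial over [E] that kills it already splits
    over the algebraic elements, so [z] is one of them. *)
Lemma algebraics_closed : GRing.closed_field_axiom algebraics.
Proof.
move=> n P n_gt0.
pose p : {poly algebraics} := 'X^n - \poly_(j < n) P j.
have sz_r : (size (- \poly_(j < n) P j) < size ('X^n : {poly algebraics}))%N.
  by rewrite size_polyN size_polyXn ltnS size_poly.
have mon_p : p \is monic by rewrite monicE lead_coefDl // lead_coefXn.
have [|L [k [[|z zs] pE]]] := @exists_splitting_field algebraics p.
- exact: monic_neq0.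
- have := size_map_poly k p; rewrite pE big_nil alg_polyC lead_coef_map.
  rewrite (monicP mon_p) rmorph1 size_poly1 size_polyDl // size_polyXn.
  by case=> n0; rewrite -n0 in n_gt0.
have pz : root (map_poly k p) z
  by rewrite pE big_cons rootZ ?rootM ?root_XsubC ?eqxx // lead_coef_eq0
    map_poly_eq0 monic_neq0.
(* Transitivity of algebraicity: z is a root of a polynomial over E. *)
have [q mon_q qz] : integralOver (k \o to_algebraics) z.
  apply: (integral_root_monic _ pz); first by rewrite monic_map.
  move=> _ /(nthP 0)[j _ <-]; rewrite coef_map; apply/integral_algebraic.
  have [q q0 qr] := algebraics_algebraic p`_j; exists q => //.
  by rewrite map_poly_comp fmorph_root.
have [rs qE] := i_splits (monic_neq0 mon_q).
have q_rs : map_poly to_algebraics q =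
            \prod_(r <- [seq insubd (0 : algebraics) r | r <- rs]) ('X - r%:P).
  apply: (map_poly_inj (val : {rmorphism algebraics -> K})).
  rewrite -map_poly_comp (eq_map_poly (g := i)) // big_map map_prod_XsubC qE.
  rewrite lead_coef_map (monicP mon_q) rmorph1 scale1r !big_seq.
  apply: eq_bigr => r rs_r; rewrite /= insubdK //.
  apply/algebraic_inP; exists q; first exact: monic_neq0.
  by rewrite qE rootZ ?root_prod_XsubC // lead_coef_eq0 map_poly_eq0 monic_neq0.
move: qz; rewrite map_poly_comp q_rs map_prod_XsubC; move: (map _ _) => rs' qz.
have [r pr] : exists r, root p r.
  have : z \in map k rs'.
    by rewrite -root_prod_XsubC big_map.
  by case/mapP => r _ zE; exists r; rewrite -(fmorph_root k) -zE.
exists r; apply/eqP; rewrite -subr_eq0; move: pr; rewrite /root !hornerE.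
congr (_ - _ == 0); apply/esym; rewrite horner_poly //.
Qed.
End AlgebraicElements.

Lemma exists_algebraic_closure :
  exists (K : closedFieldType) (i : {rmorphism E -> K}), algebraic_ext i.
Proof.
have [K [i K_splits]] := exists_universal_splitting_field.
exists (HB.pack_for closedFieldType (algebraics i)
  (Field_isAlgClosed.Build (algebraics i) (algebraics_closed K_splits))).
exists (to_algebraics i).
exact: algebraics_algebraic.
Qed.
End AlgebraicClosure.

(** * Ordered abelian groups *)

Section OAGExtra.
Variable D : oagType.
Implicit Types x y z : D.

Lemma oag_ltNge x y : (x < y) = ~~ (y <= x).
Proof. by case: (comparable_leP (oag_total y x)). Qed.

Lemma oag_leNgt x y : (x <= y) = ~~ (y < x).
Proof. by rewrite oag_ltNge negbK. Qed.

Lemma oag_neq_lt x y : x != y -> (x < y) || (y < x).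
Proof. by case: (comparable_ltgtP (oag_total x y)). Qed.

Lemma oag_lerMn x y n : x <= y -> x *+ n <= y *+ n.
Proof. by move=> xy; elim: n => // n IHn; rewrite !mulrS oag_lerD. Qed.

Lemma oag_ltrMn x y n : (0 < n)%N -> x < y -> x *+ n < y *+ n.
Proof.
by case: n => // n _ xy; rewrite !mulrS oag_ltr_leD // oag_lerMn // ltW.
Qed.

Lemma oag_mulIn n x y : (0 < n)%N -> x *+ n = y *+ n -> x = y.
Proof.
move=> n0 xy; apply: contraTeq isT => /oag_neq_lt /orP[]/(oag_ltrMn n0);
by rewrite xy ltxx.
Qed.

Lemma subr_mulrnD (l d e : D) i j :
  (d - l *+ i) + (e - l *+ j) = (d + e) - l *+ (i + j).
Proof. by rewrite mulrnDr opprD addrACA. Qed.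

End OAGExtra.

(** * Homogeneous elements of GE *)

Section Graded.
Variables (D : oagType) (E : fieldType) (v : valuation D E).
Implicit Types (g h d e : D) (x y : E) (a b : graded v).

Lemma vgt_vge_trans g h x : vge v h x -> g < h -> vgt v g x.
Proof. by rewrite /vge /vgt; case: eqP => //= _ hx gh; apply: lt_le_trans hx. Qed.

Lemma vge_sum (I : Type) (r : seq I) (F : I -> E) g :
  (forall i, vge v g (F i)) -> vge v g (\sum_(i <- r) F i).
Proof. by move=> Fg; elim/big_rec: _ => [|i x _]; [apply: vge0 | apply: vgeD]. Qed.

Lemma vgt_sum (I : Type) (r : seq I) (F : I -> E) g :
  (forall i, vgt v g (F i)) -> vgt v g (\sum_(i <- r) F i).
Proof. by move=> Fg; elim/big_rec: _ => [|i x _]; [apply: vgt0 | apply: vgtD]. Qed.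

Lemma vgeX g x n : vge v g x -> vge v (g *+ n) (x ^+ n).
Proof.
move=> gx; elim: n => [|n IHn]; first exact: vge01.
by rewrite exprS mulrS vgeM.
Qed.

Lemma vge1 : vge v 0 1. Proof. exact: vge01. Qed.

(** A product of [n] elements of value at most [g] has value at most [n g]. *)
Lemma vgt_prod_has g (r : seq E) :
  vgt v (g *+ size r) (\prod_(x <- r) x) -> has (vgt v g) r.
Proof.
apply: contraLR => /hasPn r_g; have r0 x : x \in r -> x != 0.
  by move/r_g; apply: contraNneq => ->; apply: vgt0.
elim: r r_g r0 => [|x r IHr] r_g r0.
  by rewrite big_nil /vgt oner_eq0 valuation1 ltxx.
have {}IHr : ~~ vgt v (g *+ size r) (\prod_(y <- r) y).
  by apply: IHr => y yr; [apply: r_g | apply: r0]; rewrite inE yr orbT.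
have := r_g x (mem_head _ _); move: IHr.
rewrite /= big_cons /vgt mulf_eq0 !negb_or -!oag_leNgt.
move=> /andP[pr0 pr_g] /andP[x0 x_g]; rewrite x0 pr0 valuationM //=.
by rewrite mulrS oag_lerD.
Qed.

Lemma gclass0 g : gclass v g 0 = 0.
Proof. by apply/eqP; rewrite gclass_eq0 ?vge0 ?vgt0. Qed.

Lemma gclassN g x : vge v g x -> gclass v g (- x) = - gclass v g x.
Proof.
move=> gx; apply/eqP; rewrite -subr_eq0 opprK -gclassD ?vgeN //.
by rewrite addNr gclass0.
Qed.

Lemma gclassB g x y : vge v g x -> vge v g y ->
  gclass v g (x - y) = gclass v g x - gclass v g y.
Proof. by move=> gx gy; rewrite gclassD ?vgeN // gclassN. Qed.

Lemma gclass_eq g x y : vge v g x -> vge v g y ->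
  (gclass v g x == gclass v g y) = vgt v g (x - y).
Proof. by move=> gx gy; rewrite -subr_eq0 -gclassB // gclass_eq0 // vgeD ?vgeN. Qed.

Lemma gclass_sum (I : Type) (r : seq I) (F : I -> E) g :
  (forall i, vge v g (F i)) ->
  gclass v g (\sum_(i <- r) F i) = \sum_(i <- r) gclass v g (F i).
Proof.
move=> Fg; elim: r => [|i r IHr]; first by rewrite !big_nil gclass0.
by rewrite !big_cons gclassD ?vge_sum // IHr.
Qed.

Lemma gclassX g x n : vge v g x -> gclass v g x ^+ n = gclass v (g *+ n) (x ^+ n).
Proof.
move=> gx; elim: n => [|n IHn]; first by rewrite gclass1.
by rewrite exprS IHn gclassM ?vgeX // mulrS exprS.
Qed.

Lemma gclass_out g x : ~~ vge v g x -> gclass v g x = 0.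
Proof. by move=> gx; rewrite /gclass /gclass_repr insubF // (negPf gx). Qed.

Lemma gclass_neq0 g x : gclass v g x != 0 -> x != 0 /\ v x = g.
Proof.
have [gx|/gclass_out->] := boolP (vge v g x); last by rewrite eqxx.
rewrite gclass_eq0 // /vgt negb_or => /andP[x0]; rewrite -oag_leNgt => xg.
split=> //; apply/eqP; rewrite eq_le xg /=.
by move: gx; rewrite /vge (negPf x0).
Qed.

Lemma gclass_tilde g x : gclass v g x != 0 -> gclass v g x = tilde v x.
Proof. by case/gclass_neq0 => x0 <-; rewrite /tilde (negPf x0). Qed.

Lemma tilde_neq0 x : x != 0 -> tilde v x != 0.
Proof.
by move=> x0; rewrite /tilde (negPf x0) gclass_eq0 ?vge_val // /vgt (negPf x0) ltxx.
Qed.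

Lemma tilde1 : tilde v 1 = 1.
Proof. by rewrite /tilde oner_eq0 valuation1 gclass1. Qed.

Lemma tildeN x : tilde v (- x) = - tilde v x.
Proof.
rewrite /tilde oppr_eq0 valuationN; case: eqP => [|_]; first by rewrite oppr0.
by rewrite gclassN ?vge_val.
Qed.

Lemma homogeneous_neq0 g a : homogeneous_of g a -> a != 0 ->
  exists x, [/\ x != 0, v x = g & a = tilde v x].
Proof.
case=> x _ -> x0; have [? ?] := gclass_neq0 x0; exists x; split=> //.
exact: gclass_tilde.
Qed.

Lemma homogeneous_unit g a : homogeneous_of g a -> a != 0 -> exists b, a * b = 1.
Proof.
move=> ga /(homogeneous_neq0 ga)[x [x0 _ ->]]; exists (tilde v x^-1).
by rewrite tildeM mulfV ?tilde1.
Qed.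

(** The projection of GE onto its summand of grade [g]. *)
Definition component g a : graded v := gclass v g (gcomp (repr a) g).

Lemma component_pi g s :
  component g (\pi_(graded v)%qT s) = gclass v g (gcomp s g).
Proof. by apply/eqP; rewrite gclass_eq ?gcomp_vge ?gcomp_repr. Qed.

Lemma component0 g : component g 0 = 0.
Proof. by rewrite component_pi gcomp_nil gclass0. Qed.

Lemma componentD g a b : component g (a + b) = component g a + component g b.
Proof.
rewrite -[a]reprK -[b]reprK [X in component g X](graded_addE (repr a) (repr b)).
by rewrite !component_pi gcomp_cat gclassD ?gcomp_vge.
Qed.

Lemma component_gclass g h x :
  component g (gclass v h x) = if g == h then gclass v h x else 0.
Proof.
have [hx|/gclass_out->] := boolP (vge v h x); last by rewrite component0 if_same.
rewrite component_pi gcomp_gclass_repr //.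
by case: eqP => [->//|_]; rewrite gclass0.
Qed.

Lemma component_homogeneous g h a : homogeneous_of h a ->
  component g a = if g == h then a else 0.
Proof. by case=> x _ ->; apply: component_gclass. Qed.

Lemma homogeneous_component g a : homogeneous_of g (component g a).
Proof. by exists (gcomp (repr a) g) => //; apply: gcomp_vge. Qed.

End Graded.

(** * Initial forms and the grading of GE[X] *)

Section Bounded.
Variables (D : oagType) (E : fieldType) (v : valuation D E) (lam : D).
Implicit Types (d e : D) (P Q : {poly E}) (p q : {poly graded v}).

(** The Gauss valuation of [P] that gives [lam] to the variable is at least
    [d]. *)
Definition bounded d P := forall i, vge v (d - lam *+ i) P`_i.

(** The class of [P] in the summand of grade [d] of the graded ring of the
    Gauss valuation, which is the ring GE[X] graded by giving [lam] to the
    variable. *)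
Definition initial_form d P : {poly graded v} :=
  \poly_(i < size P) gclass v (d - lam *+ i) P`_i.

Lemma coef_initial_form d P i :
  (initial_form d P)`_i = gclass v (d - lam *+ i) P`_i.
Proof.
by rewrite coef_poly; case: ltnP => // Pi; rewrite nth_default // gclass0.
Qed.

Lemma boundedD d P Q : bounded d P -> bounded d Q -> bounded d (P + Q).
Proof. by move=> dP dQ i; rewrite coefD vgeD. Qed.

Lemma boundedN d P : bounded d P -> bounded d (- P).
Proof. by move=> dP i; rewrite coefN vgeN. Qed.

Lemma boundedB d P Q : bounded d P -> bounded d Q -> bounded d (P - Q).
Proof. by move=> dP dQ; apply/boundedD/boundedN. Qed.

Lemma boundedM d e P Q : bounded d P -> bounded e Q -> bounded (d + e) (P * Q).
Proof.
move=> dP eQ i; rewrite coefM; apply: vge_sum => j.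
by rewrite -{1}(subnKC (ltn_ord j : j <= i)%N) -subr_mulrnD vgeM.
Qed.

Lemma bounded_monomial d c n :
  vge v (d - lam *+ n) c -> bounded d (c *: 'X^n).
Proof.
move=> dc i; rewrite coefZ coefXn; case: eqP => [->|_]; first by rewrite mulr1.
by rewrite mulr0 vge0.
Qed.

Lemma boundedC d c : vge v d c -> bounded d c%:P.
Proof.
by move=> dc i; rewrite coefC; case: eqP => [->|_]; rewrite ?subr0 ?vge0.
Qed.

Lemma initial_formD d P Q : bounded d P -> bounded d Q ->
  initial_form d (P + Q) = initial_form d P + initial_form d Q.
Proof.
move=> dP dQ; apply/polyP => i.
by rewrite coefD !coef_initial_form coefD gclassD.
Qed.

Lemma initial_formM d e P Q : bounded d P -> bounded e Q ->
  initial_form (d + e) (P * Q) = initial_form d P * initial_form e Q.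
Proof.
move=> dP eQ; apply/polyP => i; rewrite coef_initial_form !coefM gclass_sum.
  apply: eq_bigr => j _; rewrite !coef_initial_form gclassM // subr_mulrnD.
  by rewrite subnKC // -ltnS.
move=> j; rewrite -{1}(subnKC (ltn_ord j : j <= i)%N) -subr_mulrnD.
by rewrite vgeM.
Qed.

Lemma initial_form_eqP d P Q : bounded d P -> bounded d Q ->
  initial_form d P = initial_form d Q <->
  forall i, vgt v (d - lam *+ i) (P - Q)`_i.
Proof.
move=> dP dQ; split=> [PQ i|PQ].
  by rewrite coefB -gclass_eq // -!coef_initial_form PQ.
apply/polyP => i; rewrite !coef_initial_form; apply/eqP.
by rewrite gclass_eq // -coefB.
Qed.

Lemma size_initial_form d P : (size (initial_form d P) <= size P)%N.
Proof. exact: size_poly. Qed.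

(** The term [P`_i * x ^+ i] has grade [(d - i lam) + i lam = d], whence evaluation
    commutes with reduction. *)
Lemma horner_initial_form d P x : bounded d P -> vge v lam x ->
  vge v d P.[x] /\ (initial_form d P).[gclass v lam x] = gclass v d P.[x].
Proof.
move=> dP lx.
have term i : vge v d (P`_i * x ^+ i).
  by rewrite -[d](subrK (lam *+ i)) vgeM ?vgeX.
rewrite horner_poly horner_coef; split; first exact: vge_sum.
rewrite gclass_sum //; apply: eq_bigr => i _.
by rewrite gclassX // gclassM ?vgeX // subrK.
Qed.

Lemma vge_horner d P x : bounded d P -> vge v lam x -> vge v d P.[x].
Proof. by move=> dP lx; have [] := horner_initial_form dP lx. Qed.

(** Both memberships express that one and the same homogeneous polynomial
    vanishes at one and the same residue class. *)
Lemma vgt_horner_congr d P Q x y : bounded d P -> bounded d Q ->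
  vge v lam x -> vge v lam y ->
  initial_form d P = initial_form d Q -> vgt v lam (x - y) ->
  vgt v d P.[x] -> vgt v d Q.[y].
Proof.
move=> dP dQ lx ly PQ xy.
have [? Px] := horner_initial_form dP lx.
have [? Qy] := horner_initial_form dQ ly.
rewrite -!gclass_eq0 // -Px -Qy PQ.
by rewrite (eqP (_ : gclass v lam x == gclass v lam y)) // gclass_eq.
Qed.

Lemma homogeneous_initial_form d P : bounded d P ->
  homogeneous_poly_of lam d (initial_form d P).
Proof. by move=> dP i; exists P`_i; rewrite ?coef_initial_form. Qed.

(** Homogeneous polynomials are exactly the initial forms, which allows to
    argue in [E[X]], a Euclidean ring, instead of GE[X]. Keeping the size makes
    the leading coefficient of the lift have exactly the expected value. *)
Lemma homogeneous_lift d p : homogeneous_poly_of lam d p ->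
  exists P, [/\ bounded d P, initial_form d P = p & size P = size p].
Proof.
move=> dp.
have /choice[x xP] : forall i, exists x, vge v (d - lam *+ i) x /\
    p`_i = gclass v (d - lam *+ i) x.
  by move=> i; have [x ? ?] := dp i; exists x.
exists (\poly_(i < size p) x i); split.
- by move=> i; rewrite coef_poly; case: ifP => _; [case: (xP i) | apply: vge0].
- apply/polyP => i; rewrite coef_initial_form coef_poly; case: ltnP => pi.
    by case: (xP i).
  by rewrite gclass0 nth_default.
- have [->|p0] := eqVneq p 0;
  first by rewrite size_poly0 poly_def big_ord0 size_poly0.
  apply: size_poly_eq; have [_ pE] := xP (size p).-1.
  by move: p0; rewrite -lead_coef_eq0 lead_coefE pE => /gclass_neq0[].
Qed.

Lemma bounded_lead_val d P : bounded d P ->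
  size (initial_form d P) = size P -> P != 0 ->
  v (lead_coef P) = d - lam *+ (size P).-1.
Proof.
move=> dP szP P0; have : initial_form d P != 0
  by rewrite -size_poly_eq0 szP size_poly_eq0.
by rewrite -lead_coef_eq0 lead_coefE szP coef_initial_form => /gclass_neq0[].
Qed.

(** The projection of GE[X] onto its summand of grade [d]. *)
Definition poly_component d p : {poly graded v} :=
  \poly_(i < size p) component (d - lam *+ i) p`_i.

Lemma coef_poly_component d p i :
  (poly_component d p)`_i = component (d - lam *+ i) p`_i.
Proof.
by rewrite coef_poly; case: ltnP => // pi; rewrite nth_default // component0.
Qed.

Lemma poly_componentD d p q :
  poly_component d (p + q) = poly_component d p + poly_component d q.
Proof. by apply/polyP => i; rewrite !(coefD, coef_poly_component) componentD. Qed.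

Lemma poly_component0 d : poly_component d 0 = 0.
Proof. by apply/polyP => i; rewrite coef_poly_component !coef0 component0. Qed.

Lemma poly_component_sum d (I : Type) (r : seq I) (F : I -> {poly graded v}) :
  poly_component d (\sum_(i <- r) F i) = \sum_(i <- r) poly_component d (F i).
Proof.
elim: r => [|i r IHr]; first by rewrite !big_nil poly_component0.
by rewrite !big_cons poly_componentD IHr.
Qed.

Lemma poly_component_homogeneous d e p : homogeneous_poly_of lam e p ->
  poly_component d p = if d == e then p else 0.
Proof.
move=> ep; apply/polyP => i.
rewrite coef_poly_component (component_homogeneous _ (ep i)).
rewrite (inj_eq (addIr _)); by case: ifP; rewrite ?coef0.
Qed.

Lemma homogeneous_poly_component d p : homogeneous_poly_of lam d
  (poly_component d p).
Proof. by move=> i; rewrite coef_poly_component; apply: homogeneous_component. Qed.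

Lemma homogeneous_polyM d e p q : homogeneous_poly_of lam d p ->
  homogeneous_poly_of lam e q -> homogeneous_poly_of lam (d + e) (p * q).
Proof.
move=> /homogeneous_lift[P [dP <- _]] /homogeneous_lift[Q [eQ <- _]].
by rewrite -initial_formM //; apply/homogeneous_initial_form/boundedM.
Qed.

Lemma homogeneous_grade_uniq d e p : p != 0 ->
  homogeneous_poly_of lam d p -> homogeneous_poly_of lam e p -> d = e.
Proof.
move=> p0 dp ep; apply: contraNeq p0 => de.
have := poly_component_homogeneous d dp.
by rewrite eqxx (poly_component_homogeneous _ ep) (negPf de) => <-.
Qed.

Lemma homogeneous_lead_unit d p : homogeneous_poly_of lam d p -> p != 0 ->
  exists b, lead_coef p * b = 1.
Proof.
move=> dp; rewrite -lead_coef_eq0; apply: homogeneous_unit (dp _).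
Qed.

(** Leading coefficients of homogeneous polynomials are units of GE. *)
Lemma size_homogeneousM d p q : homogeneous_poly_of lam d p -> p != 0 -> q != 0 ->
  size (p * q) = (size p + size q).-1.
Proof.
move=> dp p0 q0; apply: size_proper_mul.
have [b pb] := homogeneous_lead_unit dp p0.
apply: contraNneq q0 => pq; rewrite -lead_coef_eq0.
by rewrite -[lead_coef q]mul1r -pb mulrAC pq mul0r.
Qed.

Lemma homogeneous_mul_neq0 d p q : homogeneous_poly_of lam d p ->
  p != 0 -> q != 0 -> p * q != 0.
Proof.
move=> dp p0 q0; rewrite -size_poly_gt0 (size_homogeneousM dp) //.
rewrite -!size_poly_gt0 in p0 q0; case: (size p) p0 => // n _.
by rewrite addSn /= addn_gt0 q0 orbT.
Qed.

(** Monomials with homogeneous coefficients generate GE[X] additively, and those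
    of the same grade can be grouped. *)
Lemma homogeneous_decomp p : exists r : seq D, [/\ uniq r,
  p = \sum_(d <- r) poly_component d p &
  forall d, poly_component d p != 0 -> d \in r].
Proof.
have [l l_hom pE] : exists2 l : seq (D * {poly graded v}),
    (forall x, x \in l -> homogeneous_poly_of lam x.1 x.2) & p = \sum_(x <- l) x.2.
  elim/poly_ind: p => [|p c [l l_hom pE]]; first by exists nil; rewrite ?big_nil.
  have [s cE] := graded_decomp c.
  exists ([seq (x.1 + lam, x.2 * 'X) | x <- l] ++
          [seq (grade t, (gclass v (grade t) (gcoef t))%:P) | t <- s]).
    move=> x; rewrite mem_cat => /orP[]/mapP[y yl ->] i /=.
      rewrite coefMX; case: i => [|i] /=.
        by exists 0; rewrite ?vge0 ?gclass0.
      by have := l_hom y yl i; rewrite mulrS opprD addrA addrK.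
    rewrite coefC; case: eqP => [->|_]; last by exists 0; rewrite ?vge0 ?gclass0.
    by rewrite subr0; exists (gcoef y) => //; apply: gtermP.
  by rewrite big_cat !big_map /= -mulr_suml -pE [in LHS]cE (rmorph_sum (@polyC _)).
(* Group the homogeneous terms by grade. *)
exists (undup (map fst l)).
have compE d : poly_component d p = \sum_(x <- l) if d == x.1 then x.2 else 0.
  rewrite pE poly_component_sum !big_seq; apply: eq_bigr => x /l_hom.
  exact: poly_component_homogeneous.
split=> [||d]; first exact: undup_uniq; last first.
  rewrite compE mem_undup; apply: contraNT => dl.
  rewrite big_seq big1 // => x xl.
  by case: eqP dl => // ->; rewrite map_f.
rewrite (eq_bigr _ (fun d _ => compE d)) exchange_big /= {1}pE !big_seq.
apply: eq_bigr => x xl.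
rewrite (bigD1_seq x.1) ?undup_uniq ?mem_undup ?map_f //= eqxx big1 ?addr0 //.
by move=> d /negPf->.
Qed.


(** The order of [D] or the opposite one, so as to treat the highest and the
    lowest homogeneous components at once. *)
Definition orient (s : bool) : rel D := fun x y => if s then x < y else y < x.

Lemma orient_add s d e d' e' :
  d = d' \/ orient s d d' -> orient s e e' -> orient s (d + e) (d' + e').
Proof.
rewrite /orient => dd' ee'; rewrite !(addrC _ e) !(addrC _ e').
by case: dd' => [->|]; case: s ee' => ee'; rewrite ?oag_ltrD2 // => /ltW;
  apply: oag_ltr_leD.
Qed.

Lemma orient_total s d e : d = e \/ orient s d e \/ orient s e d.
Proof.
have [->|/oag_neq_lt/orP] := eqVneq d e; first by left.
by rewrite /orient; case: s; tauto.
Qed.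

Lemma orient_trans s : transitive (orient s).
Proof.
rewrite /orient => y x z; case: s; first exact: lt_trans.
by move=> yx zy; apply: lt_trans yx.
Qed.

Lemma orient_irr s d : orient s d d = false.
Proof. by rewrite /orient; case: s; rewrite ltxx. Qed.

Lemma extremal_mem s (P : pred D) (r : seq D) : has P r ->
  exists2 d, d \in r /\ P d & forall e, e \in r -> P e -> e = d \/ orient s e d.
Proof.
elim: r => //= x r IHr; have [r_P _|r_nP] := boolP (has P r); last first.
  rewrite orbF => Px; exists x; first by rewrite mem_head.
  move=> e; rewrite inE => /orP[/eqP->|er Pe]; first by left.
  by case/hasP: r_nP; exists e.
have [d [dr Pd] dmax] := IHr r_P.
have [Px|nPx] := boolP (P x); last first.
  exists d; first by rewrite inE dr orbT.
  by move=> e; rewrite inE => /orP[/eqP-> /(negP nPx)|] //; apply: dmax.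
have [dx|xd] : orient s d x \/ (x = d \/ orient s x d).
  by have := orient_total s d x; intuition.
  exists x; first by rewrite mem_head.
  move=> e; rewrite inE => /orP[/eqP->|er Pe]; first by left.
  by case: (dmax e er Pe) => [->|ed]; right => //; apply: orient_trans dx.
exists d; first by rewrite inE dr orbT.
by move=> e; rewrite inE => /orP[/eqP->|] //; apply: dmax.
Qed.

(** For [s = true], [d] is the highest grade occurring in [p]; for [s = false],
    the lowest. *)
Definition extremal s d p := poly_component d p != 0 /\
  forall e, poly_component e p != 0 -> e = d \/ orient s e d.

Lemma exists_extremal s p : p != 0 -> exists d, extremal s d p.
Proof.
have [r [_ pE out]] := homogeneous_decomp p => p0.
have [|d [_ d0] dmax] := @extremal_mem s (fun d => poly_component d p != 0) r.
  apply: contraNT p0 => /hasPn r0; rewrite pE big_seq big1 // => d /r0.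
  by move/negPn/eqP.
by exists d; split=> // e e0; apply: dmax (out e e0) e0.
Qed.

(** Any other pair of nonzero components has a product of a grade other than
    [d + e]. *)
Lemma extremalM s d e p q : extremal s d p -> extremal s e q ->
  poly_component (d + e) (p * q) = poly_component d p * poly_component e q.
Proof.
move=> [d0 dmax] [e0 emax].
have [r [r_uniq pE r_out]] := homogeneous_decomp p.
have [t [t_uniq qE t_out]] := homogeneous_decomp q.
have term a b : poly_component (d + e) (poly_component a p * poly_component b q) =
    if (d == a) && (e == b) then poly_component d p * poly_component e q else 0.
  rewrite (poly_component_homogeneous _ (homogeneous_polyM
    (homogeneous_poly_component a p) (homogeneous_poly_component b q))).
  have [<-|da] := eqVneq d a; first by rewrite (inj_eq (addrI _));
    case: eqP => [->|].
  rewrite /=; case: eqP => // de.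
  have [->|a0] := eqVneq (poly_component a p) 0; first by rewrite mul0r.
  have [->|b0] := eqVneq (poly_component b q) 0; first by rewrite mulr0.
  have [ad|ad] := dmax a a0; first by rewrite ad eqxx in da.
  have := orient_add (emax b b0) ad.
  by rewrite addrC -de addrC orient_irr.
rewrite {1}pE {1}qE mulr_suml poly_component_sum (bigD1_seq d) ?r_out //=.
rewrite mulr_sumr poly_component_sum (bigD1_seq e) ?t_out //= term !eqxx /=.
rewrite [X in _ + X = _]big1 => [|a ad]; last first.
  rewrite mulr_sumr poly_component_sum big1 // => b _.
  by rewrite term eq_sym (negPf ad).
rewrite big1 ?addr0 // => b be.
by rewrite term eqxx /= eq_sym (negPf be).
Qed.

(** The highest component of a product is the product of the highest
    components, and likewise for the lowest; when the product is homogeneous,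
    the highest and lowest grades of each factor must therefore agree. *)
Lemma homogeneous_factors c p q : p * q != 0 ->
  homogeneous_poly_of lam c (p * q) ->
  exists d e, [/\ d + e = c, homogeneous_poly_of lam d p &
                homogeneous_poly_of lam e q].
Proof.
move=> pq0 c_pq.
have p0 : p != 0 by apply: contraNneq pq0 => ->; rewrite mul0r.
have q0 : q != 0 by apply: contraNneq pq0 => ->; rewrite mulr0.
(* In either orientation, the extremal grades add up to that of the product. *)
have grade_sum s d e : extremal s d p -> extremal s e q -> d + e = c.
  move=> dp eq; have := extremalM dp eq.
  rewrite (poly_component_homogeneous _ c_pq); case: eqP => // _ /esym/eqP.
  by rewrite (negPf (homogeneous_mul_neq0 (homogeneous_poly_component d p) dp.1
    eq.1)).
have only d r : extremal true d r -> extremal false d r ->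
  homogeneous_poly_of lam d r.
  move=> [d0 d_max] [_ d_min]; have [t [t_uniq rE t_out]] := homogeneous_decomp r.
  rewrite rE (bigD1_seq d) ?t_out //= big1 ?addr0;
    first exact: homogeneous_poly_component.
  move=> e ed; apply: contraTeq isT => e0.
  have [/eqP|lt_ed] := d_max e e0; first by rewrite (negPf ed).
  have [/eqP|lt_de] := d_min e e0; first by rewrite (negPf ed).
  by have := lt_trans lt_ed lt_de; rewrite ltxx.
have [d1 d1p] := exists_extremal true p0; have [e1 e1q] := exists_extremal true q0.
have [d2 d2p] := exists_extremal false p0;
  have [e2 e2q] := exists_extremal false q0.
have sum1 := grade_sum _ _ _ d1p e1q; have sum2 := grade_sum _ _ _ d2p e2q.
have [d21|d21] := d1p.2 _ d2p.1.
  rewrite {}d21 in d2p sum2; have e21 : e2 = e1 by apply: (addrI d1); rewrite sum2.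
  rewrite {}e21 in e2q.
  by exists d1, e1; split=> //; apply: only.
have := orient_add (e1q.2 _ e2q.1) d21.
by rewrite addrC sum2 addrC sum1 orient_irr.
Qed.
End Bounded.

(** * Values of roots and Newton polygons with a single slope *)

(** At a point of value [m < l], when the coefficients lie on a line of slope
    [l], the values of the terms decrease with the degree. *)
Lemma oag_slope_lt (D : oagType) (l m d : D) i n : (i < n)%N -> m < l ->
  d - l *+ n + m *+ n < d - l *+ i + m *+ i.
Proof.
move=> lt_in ml; have slope k : d - l *+ k + m *+ k = d - (l - m) *+ k.
  by rewrite mulrnBl opprB addrA addrAC.
rewrite !slope -(oag_ltrD2 ((l - m) *+ n)) subrK -(subnKC (ltnW lt_in)).
rewrite mulrnDr addrA subrK -[X in X < _]addr0 ![d + _]addrC oag_ltrD2.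
rewrite -(mul0rn D (n - i)) oag_ltrMn ?subn_gt0 //.
by rewrite -(oag_ltrD2 m) add0r subrK.
Qed.

Section RootValues.
Variables (D : oagType) (E : fieldType) (v : valuation D E) (lam : D).
Implicit Types (d e : D) (P Q : {poly E}) (x y : E).

Lemma vgt_val x : vgt v (v x) x -> x = 0.
Proof. by rewrite /vgt ltxx orbF => /eqP. Qed.

Lemma valuationX x n : x != 0 -> v (x ^+ n) = v x *+ n.
Proof.
move=> x0; elim: n => [|n IHn]; first by rewrite valuation1.
by rewrite exprS valuationM ?expf_neq0 // IHn mulrS.
Qed.

(** If [x] had a value below [lam], the leading term would be the only term of
    least value of [P.[x]], which could not vanish. *)
Lemma root_vge d P x : bounded v lam d P -> P != 0 ->
  v (lead_coef P) = d - lam *+ (size P).-1 -> root P x -> vge v lam x.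
Proof.
move=> dP P0 vP /rootP Px; have [->|x0] := eqVneq x 0; first exact: vge0.
rewrite /vge (negPf x0) /= oag_leNgt; apply/negP => x_lam.
have lead0 : lead_coef P * x ^+ (size P).-1 != 0.
  by rewrite mulf_neq0 ?lead_coef_eq0 // expf_neq0.
case/eqP: lead0; apply: vgt_val; move: Px.
rewrite horner_coef -[size P]prednK ?size_poly_gt0 // big_ord_recr /= => Px.
rewrite -[X in vgt _ _ X](addKr (\sum_(i < (size P).-1) P`_i * x ^+ i)) Px addr0
  vgtN.
apply: vgt_sum => i.
apply: (@vgt_vge_trans _ _ _ _ (d - lam *+ i + v x *+ i)).
  by rewrite vgeM // vgeX // vge_val.
rewrite valuationM ?lead_coef_eq0 ?expf_neq0 // vP valuationX //.
exact: oag_slope_lt.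
Qed.

(** Were the value of [x] above [lam], reducing [P.[x] = 0] in grade [d] would
    give the class of the constant term, which is nonzero. *)
Lemma root_val d P x : bounded v lam d P -> P`_0 != 0 -> v P`_0 = d ->
  v (lead_coef P) = d - lam *+ (size P).-1 -> root P x -> x != 0 /\ v x = lam.
Proof.
move=> dP P00 vP0 vP Px.
have x0 : x != 0.
  by apply: contraTneq Px => ->; rewrite /root horner_coef0.
have P0 : P != 0 by apply: contraNneq P00 => ->; rewrite coef0.
have lx := root_vge dP P0 vP Px; split=> //; apply/eqP.
rewrite eq_le; have := lx; rewrite {1}/vge (negPf x0) /= => ->; rewrite andbT.
rewrite oag_leNgt; apply/negP => x_lam.
case/eqP: P00; apply: vgt_val; rewrite vP0 -gclass_eq0; last first.
  by have := dP 0; rewrite subr0.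
have [_] := horner_initial_form dP lx.
rewrite (rootP Px) gclass0 (eqP (_ : gclass v lam x == 0)); last first.
  by rewrite gclass_eq0 // /vgt x_lam orbT.
by rewrite horner_coef0 coef_initial_form subr0 => ->.
Qed.

(** The factor ['X - r] is bounded in grade [lam], and its constant term has
    value exactly [lam]. *)
Lemma bounded_prod_roots c (rs : seq E) : c != 0 ->
  (forall r, r \in rs -> r != 0 /\ v r = lam) ->
  let P := c *: \prod_(r <- rs) ('X - r%:P) in
  [/\ P`_0 != 0, v P`_0 = lam *+ size rs + v c & bounded v lam (v P`_0) P].
Proof.
move=> c0; elim: rs => [|r rs IHrs] rs_lam /=.
  rewrite big_nil alg_polyC coefC eqxx add0r; split=> //.
  exact/boundedC/vge_val.
have [r0 vr] := rs_lam r (mem_head _ _).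
have [|P00 vP0 dP] := IHrs; first by move=> x xrs; apply: rs_lam;
  rewrite inE xrs orbT.
rewrite big_cons scalerAr; set P := _ *: _ in P00 vP0 dP *.
have c_0 : (('X - r%:P) * P)`_0 = - r * P`_0.
  by rewrite coefM big_ord1 coefB coefX coefC /= sub0r.
have v_0 : v (- r * P`_0) = lam + v P`_0
  by rewrite valuationM ?oppr_eq0 // valuationN vr.
split; first by rewrite c_0 mulf_neq0 ?oppr_eq0.
  by rewrite c_0 v_0 vP0 /= mulrS addrA.
rewrite c_0 v_0; apply: boundedM => //; apply: boundedB;
  last by apply: boundedC; rewrite -vr vge_val.
rewrite -['X]scale1r; apply: (@bounded_monomial _ _ _ _ _ _ 1).
by rewrite subrr vge1.
Qed.

End RootValues.

Section Extension.
Variables (D : oagType) (E K : fieldType) (v : valuation D E).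
Variables (i : {rmorphism E -> K}) (w : valuation D K).
Hypothesis vw : extends i v w.

Lemma vge_extends g x : vge w g (i x) = vge v g x.
Proof. by rewrite /vge fmorph_eq0; case: eqVneq => //= x0; rewrite vw. Qed.

Lemma vgt_extends g x : vgt w g (i x) = vgt v g x.
Proof. by rewrite /vgt fmorph_eq0; case: eqVneq => //= x0; rewrite vw. Qed.

Lemma bounded_extends lam d P :
  bounded w lam d (map_poly i P) <-> bounded v lam d P.
Proof. by split=> dP j; have := dP j; rewrite coef_map vge_extends. Qed.

Lemma initial_form_eq_extends lam d P Q : bounded v lam d P -> bounded v lam d Q ->
  initial_form v lam d P = initial_form v lam d Q ->
  initial_form w lam d (map_poly i P) = initial_form w lam d (map_poly i Q).
Proof.
move=> dP dQ /(initial_form_eqP dP dQ) PQ; apply/initial_form_eqP.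
- exact/bounded_extends.
- exact/bounded_extends.
- by move=> j; rewrite -rmorphB coef_map vgt_extends.
Qed.

End Extension.

(** The Newton polygon of [f] is a single segment of slope [lam]: the
    coefficients lie above it, and the two extreme ones are its ends. *)
Definition slope_poly (D : oagType) (E : fieldType) (v : valuation D E) lam
    (f : {poly E}) :=
  [/\ f`_0 != 0, v f`_0 = lam *+ (size f).-1 + v (lead_coef f) &
      bounded v lam (v f`_0) f].

Section LambdaPolynomials.
Variables (D : oagType) (E : fieldType) (v : valuation D E).
Hypothesis hens : henselian v.

(** So the quantification over closed extensions in [lambda_poly] is not
    vacuous. *)
Lemma exists_valued_closure : exists (K : closedFieldType)
  (i : {rmorphism E -> K}) (w : valuation D K), algebraic_ext i /\ extends i v w.
Proof.
have [K [i Ki]] := exists_algebraic_closure E.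
by have [w vw _] := hens Ki; exists K, i, w.
Qed.

(** Linear polynomials with a root of value [lam] have a one-segment Newton
    polygon of slope [lam], and such polygons add up under products. *)
Lemma slope_of_roots lam (f : {poly E}) (K : closedFieldType)
    (i : {rmorphism E -> K}) (w : valuation D K) : extends i v w -> f != 0 ->
  (forall r, root (map_poly i f) r -> r != 0 /\ w r = lam) -> slope_poly v lam f.
Proof.
move=> vw f0 f_lam; have [rs fE] := closed_field_poly_normal (map_poly i f).
have c0 : lead_coef (map_poly i f) != 0 by rewrite lead_coef_eq0 map_poly_eq0.
have [|P0 vP0 dP] := @bounded_prod_roots D K w lam _ rs c0.
  by move=> r rs_r; apply: f_lam; rewrite fE rootZ // root_prod_XsubC.
have sz_rs : size rs = (size f).-1.
  have := congr1 (fun q : {poly K} => size q) fE.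
  by rewrite size_map_poly size_scale // size_prod_XsubC => ->.
rewrite -fE coef_map fmorph_eq0 in P0 vP0 dP.
rewrite vw // in vP0 dP; split=> //; last exact/(bounded_extends vw).
by rewrite vP0 sz_rs lead_coef_map vw ?lead_coef_eq0.
Qed.

Lemma slope_root_val lam (f : {poly E}) (K : fieldType) (i : {rmorphism E -> K})
    (w : valuation D K) r : extends i v w -> slope_poly v lam f ->
  root (map_poly i f) r -> r != 0 /\ w r = lam.
Proof.
move=> vw [f00 lamE df] fr.
have lead0 : lead_coef f != 0.
  by rewrite lead_coef_eq0; apply: contraNneq f00 => ->; rewrite coef0.
apply: (@root_val D K w lam (v f`_0) (map_poly i f) r) => //.
- exact/(bounded_extends vw).
- by rewrite coef_map fmorph_eq0.
- by rewrite coef_map vw.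
- by rewrite lead_coef_map size_map_poly vw // lamE addrC addKr.
Qed.

(** The roots in a valued closure determine the polygon by multiplication of the
    linear factors; conversely, both ends of the polygon bound the value of each
    root. *)
Lemma lambda_polyP lam (f : {poly E}) :
  lambda_poly v lam f <-> slope_poly v lam f.
Proof.
split=> [[/eqP/size_poly1P[c c0 ->]|[n0 f00 lamE f_lam]]|[f00 lamE df]].
- rewrite /slope_poly lead_coefC size_polyC c0 coefC /= add0r; split=> //.
  exact/boundedC/vge_val.
- have [K [i [w [Ki vw]]]] := exists_valued_closure.
  have f0 : f != 0 by apply: contraNneq f00 => ->; rewrite coef0.
  apply: (slope_of_roots vw) => // r fr; split; last exact: f_lam fr.
  apply: contraTneq fr => ->.
  by rewrite /root horner_coef0 coef_map fmorph_eq0.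
- have [sz1|sz1] := eqVneq (size f) 1%N; [by left|right].
  have f0 : f != 0 by apply: contraNneq f00 => ->; rewrite coef0.
  have sz_gt1 : (1 < size f)%N.
    by rewrite ltn_neqAle eq_sym sz1 size_poly_gt0.
  split=> //; first by rewrite -ltnS prednK // ltnW.
    by rewrite lamE addrK.
  move=> K i Ki w vw r fr.
  by have [] := slope_root_val vw (And3 f00 lamE df) fr.
Qed.

Lemma tilde_poly_initial_form lam f : slope_poly v lam f ->
  tilde_poly v lam f = initial_form v lam (v f`_0) f.
Proof.
case=> f00 lamE df; apply/polyP => j; rewrite coef_poly coef_initial_form.
case: ltnP => jf; last by rewrite (nth_default _ jf) gclass0.
have f0 : f != 0 by apply: contraNneq f00 => ->; rewrite coef0.
have -> : lam *+ ((size f).-1 - j) + v f`_(size f).-1 = v f`_0 - lam *+ j.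
  rewrite -[LHS](addrK (lam *+ j)); congr (_ - _).
  rewrite addrAC -mulrnDr subnK -?lamE //.
  by rewrite -ltnS prednK // size_poly_gt0.
have [->|fj0] := eqVneq f`_j 0; first by rewrite gclass0.
case: eqP => [<-|vj]; first by rewrite /tilde (negPf fj0).
apply/esym/eqP; rewrite gclass_eq0 //; move: (df j).
by rewrite /vge /vgt (negPf fj0) /= le_eqVlt => /orP[/eqP/esym|].
Qed.

End LambdaPolynomials.

(** * Conjugate roots over a Henselian field *)

(** A valuation says nothing at 0, so vanishing is compared separately. *)
Definition same_value (D : oagType) (K L : fieldType) (w : valuation D K)
  (u : valuation D L) x y := (x == 0) = (y == 0) /\ (x != 0 -> w x = u y).

Lemma same_value_vgt (D : oagType) (K L : fieldType) (w : valuation D K)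
  (u : valuation D L) x y g : same_value w u x y -> vgt w g x = vgt u g y.
Proof. by case=> xy; rewrite /vgt -xy; case: eqVneq => //= _ ->. Qed.

Section RootField.
Variables (D : oagType) (E : fieldType) (v : valuation D E).
Hypothesis hens : henselian v.
Variable p : {poly E}.
Hypothesis irr_p : irreducible_poly p.

(** This is where the Henselian hypothesis does its work. With [L = E[X]/(p)]
    and [z] the class of the variable, every root [r] of [p] in a valued
    extension [K] defines a valuation [P.[z] |-> w P.[r]] on [L] extending [v];
    there is only one such valuation, so the values at [z] and at [r] are the
    same. *)
Lemma exists_root_field : exists (L : fieldType) (j : {rmorphism E -> L}) (z : L)
    (u : valuation D L), [/\ extends j v u, root (map_poly j p) z &
  forall (K : fieldType) (i : {rmorphism E -> K}) (w : valuation D K) r,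
    extends i v w -> root (map_poly i p) r ->
    forall P, same_value w u (map_poly i P).[r] (map_poly j P).[z] ].
Proof.
have [L _ [z pz zL]] := irredp_FAdjoin irr_p.
pose j : {rmorphism E -> L} := in_alg L.
have alg_j : algebraic_ext j.
  move=> x; have /polyOver1P[q qE] := minPolyOver 1%AS x.
  exists q; last by rewrite -qE root_minPoly.
  by rewrite -(map_poly_eq0 j) -qE monic_neq0 ?monic_minPoly.
have [u vu u_uniq] := hens alg_j.
exists L, j, z, u; split=> // K i w r vw pr.
have eq_roots P : ((map_poly i P).[r] == 0) = ((map_poly j P).[z] == 0).
  change (root (map_poly i P) r = root (map_poly j P) z).
  by rewrite (irreducible_root_dvdp _ irr_p pr) (irreducible_root_dvdp _ irr_p pz).
have /choice[rep repE] : forall x : L, exists P, (map_poly j P).[z] = x.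
  move=> x; have /Fadjoin_polyP[q /polyOver1P[P ->] ->] : x \in <<1; z>>%VS.
    by rewrite zL memvf.
  by exists P.
have repP P : (map_poly i (rep (map_poly j P).[z])).[r] = (map_poly i P).[r].
  apply/eqP; rewrite -subr_eq0 -hornerN -hornerD -rmorphB eq_roots rmorphB.
  by rewrite hornerD hornerN repE subrr.
have rep0 x : ((map_poly i (rep x)).[r] == 0) = (x == 0) by rewrite eq_roots repE.
(* The valuation on L pulled back along z |-> r. *)
pose t x := w (map_poly i (rep x)).[r].
have tM x y : x != 0 -> y != 0 -> t (x * y) = t x + t y.
  move=> x0 y0; rewrite /t -valuationM ?rep0 //.
  rewrite -[in LHS](repE x) -[in LHS](repE y) -hornerM -rmorphM /= repP.
  by rewrite rmorphM hornerM.
have tD x y : x != 0 -> y != 0 -> x + y != 0 -> Order.min (t x) (t y) <= t (x + y).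
  move=> x0 y0 xy0.
  have xyE : (map_poly i (rep (x + y))).[r] =
             (map_poly i (rep x)).[r] + (map_poly i (rep y)).[r].
    by have := repP (rep x + rep y); rewrite !rmorphD !hornerD !repE => ->.
  by rewrite /t xyE valuationD ?rep0 // -xyE rep0.
have tu := u_uniq (Valuation tM tD) _.
move=> P; split=> [|P0]; first exact: eq_roots.
rewrite -tu; last by rewrite -eq_roots.
  by rewrite /= /t repP.
move=> x x0; have := repP x%:P; rewrite !map_polyC !hornerC /= /t => ->.
exact: vw.
Qed.

(** All roots of [p] have the same value, which is then determined by the
    constant and the leading coefficients. *)
Lemma irreducible_slope lam : p`_0 != 0 ->
    lam *+ (size p).-1 = v p`_0 - v (lead_coef p) ->
  lambda_poly v lam p.
Proof.
move=> p00 lamE; apply/(lambda_polyP hens).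
have [K [i [w [Ki vw]]]] := exists_valued_closure hens.
have [L [j [z [u [vu pz conj]]]]] := exists_root_field.
have p0 : p != 0 by apply: contraNneq p00 => ->; rewrite coef0.
have root_same r : root (map_poly i p) r -> r != 0 /\ w r = u z.
  move=> pr; have := conj K i w r vw pr 'X; rewrite !map_polyX !hornerX => -[_ r_z].
  have r0 : r != 0.
    apply: contraTneq pr => ->.
    by rewrite /root horner_coef0 coef_map fmorph_eq0.
  by split=> //; apply: r_z.
have [_ vp0 dp] := slope_of_roots vw p0 root_same.
suff <- : u z = lam by split.
apply: (@oag_mulIn _ (size p).-1).
  by case: irr_p; case: (size p) => // -[].
by rewrite lamE vp0 addrK.
Qed.

End RootField.

(** * The minimal polynomial of a residue class over GE *)

Section BoundedDivision.
Variables (D : oagType) (E : fieldType) (v : valuation D E) (lam : D).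

(** Nonzero homogeneous elements of GE have a nonzero product. *)
Lemma vgtM_or d e x y : vge v d x -> vge v e y -> vgt v (d + e) (x * y) ->
  vgt v d x \/ vgt v e y.
Proof.
move=> dx ey; rewrite -[vgt v d x]negbK -[vgt v e y]negbK => xy.
apply/orP; rewrite -negb_and; apply/negP; rewrite /vgt !negb_or -!oag_leNgt.
move=> /andP[/andP[x0 xd] /andP[y0 ye]]; move: xy.
by rewrite /vgt mulf_eq0 (negPf x0) (negPf y0) /= valuationM // oag_ltNge oag_lerD.
Qed.

Lemma vgt_horner_initial d P Q x : bounded v lam d P -> bounded v lam d Q ->
  vge v lam x -> initial_form v lam d P = initial_form v lam d Q ->
  vgt v d P.[x] -> vgt v d Q.[x].
Proof. by move=> *; apply: (vgt_horner_congr (P := P) (x := x)) => //;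
  rewrite subrr vgt0. Qed.

(** Each step of the Euclidean division subtracts from [P] a multiple of [q]
    whose Gauss valuation is at least that of [P], as [q] is monic of Gauss
    valuation [t lam]. *)
Lemma bounded_division d t (q P : {poly E}) : q \is monic -> size q = t.+1 ->
  bounded v lam (lam *+ t) q -> bounded v lam d P ->
  exists A R, [/\ P = q * A + R, (size R <= t)%N, bounded v lam (d - lam *+ t) A &
               bounded v lam d R].
Proof.
move=> mon_q sz_q dq; have [n] := ubnP (size P); elim: n P => // n IHn P Pn dP.
have [Pt|tP] := leqP (size P) t.
  exists 0, P; split=> //; first by rewrite mulr0 add0r.
  by move=> i; rewrite coef0 vge0.
set c := lead_coef P; pose m := ((size P).-1 - t)%N.
have szP_gt0 : (0 < size P)%N by apply: leq_trans tP.
have P0 : P != 0 by rewrite -size_poly_gt0.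
have sz_P : size P = (m + t).+1 by rewrite /m subnK ?prednK // -ltnS prednK.
have dA : bounded v lam (d - lam *+ t) (c *: 'X^m).
  apply: bounded_monomial; rewrite -addrA -opprD -mulrnDr addnC.
  by rewrite /c lead_coefE sz_P.
have dqA : bounded v lam d (q * (c *: 'X^m)).
  by rewrite -[d](subrKC (lam *+ t)); apply: boundedM.
have c0 : c != 0 by rewrite lead_coef_eq0.
have szqA : size (q * (c *: 'X^m)) = size P.
  by rewrite size_monicM ?scaler_eq0 ?negb_or ?c0 ?monic_neq0 ?monicXn //
    size_scale // size_polyXn sz_q sz_P addnS addSn addnC.
have [||A [R [PE szR dA' dR]]] := IHn (P - q * (c *: 'X^m)).
- rewrite -ltnS; apply: leq_trans Pn; rewrite ltnS sz_P ltnS.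
  apply/leq_sizeP => l; rewrite leq_eqVlt => /orP[/eqP<-|ml]; last first.
    by rewrite coefB !nth_default ?subrr // ?szqA sz_P.
  rewrite coefB; have -> : P`_(m + t) = c by rewrite /c lead_coefE sz_P.
  have := lead_coefE (q * (c *: 'X^m)); rewrite szqA sz_P => <-.
  by rewrite lead_coef_monicM // lead_coefZ lead_coefXn mulr1 subrr.
- exact: boundedB.
exists (A + c *: 'X^m), R; split=> //; last exact: boundedD.
by rewrite mulrDr addrAC -PE subrK.
Qed.
End BoundedDivision.

(** A homogeneous polynomial of grade [d] over GE vanishes at the class of [z]
    in grade [lam] exactly when its lifts [P] satisfy [vgt u d (ev P)]. For [q]
    a lift of the monic homogeneous polynomial of least degree vanishing there,
    the initial form [k] of [q] plays the part of the minimal polynomial of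
    that class over GE: it generates the homogeneous polynomials vanishing at
    it. *)
Section KeyPolynomial.
Variables (D : oagType) (E L : fieldType) (v : valuation D E) (lam : D).
Variables (j : {rmorphism E -> L}) (u : valuation D L) (z : L).
Hypotheses (vu : extends j v u) (uz : vge u lam z).
Local Notation ev P := (map_poly j P).[z].
Local Notation bounded := (bounded v lam).
Local Notation initial_form := (initial_form v lam).

(** [q] lifts a monic homogeneous polynomial of degree [t] that vanishes at the
    class of [z]. *)
Definition vanishing t q := [/\ q \is monic, size q = t.+1,
  bounded (lam *+ t) q & vgt u (lam *+ t) (ev q)].

Lemma vge_ev d P : bounded d P -> vge u d (ev P).
Proof. by move=> dP; apply: (vge_horner (lam := lam)) => //;
  apply/(bounded_extends vu). Qed.

Lemma vgt_ev d P Q : bounded d P -> bounded d Q ->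
  initial_form d P = initial_form d Q -> vgt u d (ev P) -> vgt u d (ev Q).
Proof.
move=> dP dQ PQ.
apply: (vgt_horner_initial _ _ uz (initial_form_eq_extends vu dP dQ PQ));
  exact/(bounded_extends vu).
Qed.

Variables (t : nat) (q : {poly E}).
Hypotheses (key_q : vanishing t q)
  (key_min : forall t' q', vanishing t' q' -> (t <= t')%N).
Let k := initial_form (lam *+ t) q.

(** Otherwise, dividing by the leading coefficient would give a monic vanishing
    polynomial of degree less than [t]. *)
Lemma small_vanishing_initial_form d R : bounded d R -> (size R <= t)%N ->
  vgt u d (ev R) -> initial_form d R = 0.
Proof.
move=> dR Rt Rz; apply: contraTeq isT => R0.
have [R' [dR' R'E szR']] := homogeneous_lift (homogeneous_initial_form dR).
have R'0 : R' != 0 by rewrite -size_poly_eq0 szR' size_poly_eq0.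
have c0 : lead_coef R' != 0 by rewrite lead_coef_eq0.
have vc : v (lead_coef R') = d - lam *+ (size R').-1.
  by apply: bounded_lead_val => //; rewrite R'E.
have gradeE : - v (lead_coef R') + d = lam *+ (size R').-1.
  by rewrite vc opprB subrK.
have v_inv : v (lead_coef R')^-1 = - v (lead_coef R').
  apply: (addrI (v (lead_coef R'))); rewrite -valuationM ?invr_eq0 //.
  by rewrite mulfV // valuation1 subrr.
have /key_min : vanishing (size R').-1 ((lead_coef R')^-1 *: R').
  split.
  - by rewrite monicE lead_coefZ mulVf.
  - by rewrite size_scale ?invr_eq0 // prednK // size_poly_gt0.
  - rewrite -gradeE -mul_polyC; apply: boundedM => //; apply: boundedC.
    by rewrite -v_inv vge_val.
  - rewrite -gradeE map_polyZ hornerZ; apply: vgtM.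
      by rewrite (vge_extends vu) -v_inv vge_val.
    exact: vgt_ev Rz.
rewrite leqNgt -ltnS prednK ?size_poly_gt0 // ltnS szR'.
by rewrite (leq_trans (size_initial_form _ _ _ _)).
Qed.

(** The remainder of the division by [q] vanishes at the class of [z] and has
    degree less than [t], so its initial form is zero. *)
Lemma vanishing_divides d P : bounded d P -> vgt u d (ev P) ->
  ring_divides k (initial_form d P).
Proof.
move=> dP Pz; have [mon_q sz_q dq qz] := key_q.
have [A [R [PE szR dA dR]]] := bounded_division mon_q sz_q dq dP.
have dqA : bounded d (q * A) by rewrite -[d](subrKC (lam *+ t)); apply: boundedM.
exists (initial_form (d - lam *+ t) A); rewrite -initial_formM // subrKC.
rewrite PE initial_formD // (small_vanishing_initial_form dR szR) ?addr0 //.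
have -> : R = P - q * A by rewrite PE addrC addKr.
rewrite rmorphB hornerD hornerN vgtD // vgtN rmorphM hornerM.
by rewrite -[d](subrKC (lam *+ t)) addrC mulrC vgtM // vge_ev.
Qed.

Lemma coef_key : k`_t = 1.
Proof.
have [mon_q sz_q _ _] := key_q; rewrite coef_initial_form subrr.
by have := monicP mon_q; rewrite lead_coefE sz_q => ->; rewrite gclass1.
Qed.

Lemma size_key : size k = t.+1.
Proof.
have [_ sz_q _ _] := key_q.
apply/eqP; rewrite eqn_leq -{1}sz_q size_initial_form ltnNge.
apply/negP => kt; have := coef_key.
by move/eqP; rewrite nth_default // eq_sym oner_eq0.
Qed.

Lemma monic_key : k \is monic.
Proof. by rewrite monicE lead_coefE size_key coef_key. Qed.

Lemma key_nonconst : (1 < size k)%N.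
Proof.
rewrite size_key ltnS lt0n; apply/eqP => t0; have [mon_q sz_q dq qz] := key_q.
move: qz; rewrite t0 in sz_q *; move/eqP/size_poly1P: sz_q => [c c0 qE].
have := mon_q; rewrite qE monicE lead_coefC => /eqP ->.
by rewrite map_polyC hornerC /= rmorph1 /vgt oner_eq0 valuation1 ltxx.
Qed.

Lemma homogeneous_key : homogeneous_poly_of lam (lam *+ t) k.
Proof. by apply: homogeneous_initial_form; have [] := key_q. Qed.

(** A product vanishes at the class of [z] only if one of its factors does. *)
Lemma key_prime d e a b : homogeneous_poly_of lam d a ->
  homogeneous_poly_of lam e b ->
  ring_divides k (a * b) -> ring_divides k a \/ ring_divides k b.
Proof.
move=> da eb [c abE]; have [mon_q sz_q dq qz] := key_q.
have [a0|a0] := eqVneq a 0; first by left; exists 0; rewrite a0 mulr0.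
have [b0|b0] := eqVneq b 0; first by right; exists 0; rewrite b0 mulr0.
have ab0 := homogeneous_mul_neq0 da a0 b0.
have hom_ab := homogeneous_polyM da eb.
rewrite abE in ab0 hom_ab.
have [t' [g [gradeE hom_k hom_c]]] := homogeneous_factors ab0 hom_ab.
rewrite -(homogeneous_grade_uniq (monic_neq0 monic_key) homogeneous_key hom_k)
  in gradeE.
have [A [dA AE _]] := homogeneous_lift da.
have [B [eB BE _]] := homogeneous_lift eb.
have [C [gC CE _]] := homogeneous_lift hom_c.
have AB : initial_form (d + e) (q * C) = initial_form (d + e) (A * B).
  by rewrite -{1}gradeE !initial_formM // AE BE CE abE.
have : vgt u (d + e) (ev (A * B)).
  apply: vgt_ev AB _; first by rewrite -gradeE; apply: boundedM.
    exact: boundedM.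
  by rewrite rmorphM hornerM mulrC -gradeE addrC vgtM // vge_ev.
rewrite rmorphM hornerM => /vgtM_or[||Az|Bz]; try exact: vge_ev.
  by left; rewrite -AE; apply: vanishing_divides.
by right; rewrite -BE; apply: vanishing_divides.
Qed.

(** The factors of [k] are homogeneous, so primality applies to [k = b c]; the
    factor divided by [k] has a unit as cofactor. *)
Lemma key_irreducible : ring_irreducible k.
Proof.
split; first exact: monic_neq0 monic_key.
  exact: monic_not_unit monic_key key_nonconst.
move=> b c kE; have k0 := monic_neq0 monic_key; have := homogeneous_key.
rewrite kE in k0 * => /(homogeneous_factors k0)[d [e [_ db ec]]].
have kbc : ring_divides k (b * c) by exists 1; rewrite mulr1.
have [[b' bE]|[c' cE]] := key_prime db ec kbc.
- right; exists b'; apply: (monic_mulI monic_key).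
  by rewrite mulr1 {2}kE bE mulrA mulrAC.
- left; exists c'; apply: (monic_mulI monic_key).
  by rewrite mulr1 {2}kE cE mulrCA.
Qed.

End KeyPolynomial.

(** * Initial forms of irreducible polynomials *)

Section IrreducibleInitialForm.
Variables (D : oagType) (E : fieldType) (v : valuation D E) (lam : D).
Hypothesis hens : henselian v.

(** Primality tested on homogeneous polynomials only, which is all that
    factoring a homogeneous polynomial requires. *)
Definition homogeneous_prime (k : {poly graded v}) :=
  forall d e a b, homogeneous_poly_of lam d a -> homogeneous_poly_of lam e b ->
  ring_divides k (a * b) -> ring_divides k a \/ ring_divides k b.

(** Write the initial form as [k ^ s m] with [k] not dividing [m], [k] being
    the minimal polynomial of the class of the root [z], and let [M] lift [m].
    If [M] had a root [rho], then [p.[rho]] would have a value larger than the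
    grade, so [rho] would be congruent to some root [r] of [p]; then [M] would
    vanish at the class of [r], hence at that of its conjugate [z], and [k]
    would divide [m]. *)
Lemma irreducible_initial_form (p : {poly E}) :
  p \is monic -> irreducible_poly p -> slope_poly v lam p ->
  exists k s, [/\ ring_irreducible k, k \is monic, homogenizable lam k, (0 < s)%N &
                initial_form v lam (v p`_0) p = k ^+ s] /\ homogeneous_prime k.
Proof.
move=> mon_p irr_p [p00 vp0 dp].
have vp0' : v p`_0 = lam *+ (size p).-1.
  by rewrite vp0 (monicP mon_p) valuation1 addr0.
have [L [j [z [u [vu pz conj]]]]] := exists_root_field hens irr_p.
have [K [i [w [Ki vw]]]] := exists_valued_closure hens.
have szp : size p = (size p).-1.+1 by rewrite prednK // size_poly_gt0 monic_neq0.
have uz : vge u lam z.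
  apply: (root_vge (d := v p`_0) _ _ _ pz); first exact/(bounded_extends vu).
    by rewrite map_poly_eq0 monic_neq0.
  by rewrite lead_coef_map (monicP mon_p) rmorph1 valuation1 size_map_poly vp0'
    subrr.
have van_p : vanishing v lam j u z (size p).-1 p.
  by split; rewrite // -?vp0' // (rootP pz) vgt0.
have [t [[q key_q] t_min]] := exists_minimal (ex_intro
  (fun t => exists q, vanishing v lam j u z t q) _ (ex_intro _ p van_p)).
have key_min t' q' : vanishing v lam j u z t' q' -> (t <= t')%N.
  by move=> vq'; apply: t_min; exists q'.
set k := initial_form v lam (lam *+ t) q.
have mon_k : k \is monic := monic_key key_q.
have k1 : (1 < size k)%N := key_nonconst key_q.
have irr_k : ring_irreducible k := key_irreducible vu uz key_q key_min.
set pt := initial_form v lam (v p`_0) p.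
have pt0 : pt`_(size p).-1 = 1.
  rewrite coef_initial_form vp0' subrr -lead_coefE (monicP mon_p).
  exact: gclass1.
have pt_neq0 : pt != 0.
  by apply: contra_eqN pt0 => /eqP->; rewrite coef0 eq_sym oner_eq0.
have szpt : size pt = size p.
  apply/eqP; rewrite eqn_leq size_initial_form {1}szp ltnNge.
  by apply/negP => szpt; move/eqP: pt0; rewrite nth_default // eq_sym oner_eq0.
have [s [m [ptE km]]] := monic_multiplicity mon_k k1 pt_neq0.
exists k, s; split; last first.
  by move=> d e a b; apply: (key_prime vu uz key_q key_min).
have lead_m : lead_coef m = 1.
  rewrite -(lead_coef_monicM m (monic_exp s mon_k)) -ptE lead_coefE szpt.
  exact: pt0.
suff m1 : m = 1.
  split=> //; last by rewrite ptE m1 mulr1.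
    by exists (lam *+ t); apply: homogeneous_key key_q.
  rewrite lt0n; apply/eqP => s0; apply: km; rewrite m1.
  have -> : 1 = pt by rewrite ptE s0 m1 mulr1.
  apply: (vanishing_divides vu uz key_q key_min) => //.
  by rewrite (rootP pz) vgt0.
have hom_pt := homogeneous_initial_form dp.
have nz := pt_neq0; rewrite -/pt ptE in hom_pt nz.
(* The cofactor m is homogeneous, hence lifts to some M, which does not vanish
   at the class of z. *)
have [e [d [gradeE hom_ks hom_m]]] := homogeneous_factors nz hom_pt.
have m0 : m != 0 by apply: contraNneq nz => ->; rewrite mulr0.
have [M [dM ME szM]] := homogeneous_lift hom_m.
have Mz : ~ vgt u d (map_poly j M).[z].
  move=> Mz; apply: km; rewrite -ME.
  exact: (vanishing_divides vu uz key_q key_min).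
have [sz_m|sz_m] := leqP (size m) 1.
  by rewrite (size1_polyC sz_m) -[m`_0]lead_coefC -(size1_polyC sz_m) lead_m.
exfalso.
have [rho Mrho] : exists rho, root (map_poly i M) rho.
  apply/closed_rootP; rewrite size_map_poly szM.
  by rewrite gtn_eqF.
have M0 : M != 0 by rewrite -size_poly_eq0 szM size_poly_eq0.
(* M and k ^ s m have slope lam or more, so p.[rho] can be computed modulo
   higher values from any lift of k ^ s m, such as Q * M, which kills rho. *)
have rho_lam : vge w lam rho.
  apply: (root_vge (d := d) _ _ _ Mrho); first exact/(bounded_extends vw).
    by rewrite map_poly_eq0.
  rewrite lead_coef_map vw ?lead_coef_eq0 // size_map_poly.
  by apply: bounded_lead_val; rewrite // ME.
have [Q [dQ QE _]] := homogeneous_lift hom_ks.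
have p_rho : vgt w (v p`_0) (map_poly i p).[rho].
  have dQM : bounded v lam (v p`_0) (Q * M) by rewrite -gradeE; apply: boundedM.
  have QMp : initial_form v lam (v p`_0) (Q * M) = initial_form v lam (v p`_0) p.
    by rewrite -{1}gradeE initial_formM // QE ME -ptE.
  apply: (vgt_ev vw rho_lam dQM dp QMp).
  by rewrite rmorphM hornerM (rootP Mrho) mulr0 vgt0.
(* As p.[rho] is the product of the rho - r, some r is congruent to rho. *)
have [rs pE] := closed_field_poly_normal (map_poly i p).
move: pE; rewrite lead_coef_map (monicP mon_p) rmorph1 scale1r => pE.
have sz_rs : size rs = (size p).-1.
  have := congr1 (fun q : {poly K} => size q) pE.
  by rewrite size_map_poly size_prod_XsubC => ->.
have /hasP[x /mapP[r rs_r ->] rho_r] : has (vgt w lam) [seq rho - r | r <- rs].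
  apply: vgt_prod_has; rewrite size_map sz_rs -vp0' big_map.
  move: p_rho; rewrite pE horner_prod; congr vgt.
  by apply: eq_bigr => r _; rewrite hornerXsubC.
have pr : root (map_poly i p) r by rewrite pE root_prod_XsubC.
have r_lam : vge w lam r.
  apply: (root_vge (d := v p`_0) _ _ _ pr); first exact/(bounded_extends vw).
    by rewrite map_poly_eq0 monic_neq0.
  by rewrite lead_coef_map (monicP mon_p) rmorph1 valuation1 size_map_poly vp0'
    subrr.
apply: Mz; rewrite -(same_value_vgt _ (conj K i w r vw pr M)).
have diM : bounded w lam d (map_poly i M) by apply/(bounded_extends vw).
apply: (vgt_horner_congr diM diM rho_lam r_lam erefl rho_r).
by rewrite (rootP Mrho) vgt0.
Qed.

End IrreducibleInitialForm.

(** * Lifting coprime factorizations *)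

Section SlopeTilde.
Variables (D : oagType) (E : fieldType) (v : valuation D E) (lam : D).
Implicit Types (f g h : {poly E}) (a : graded v) (p q : {poly graded v}).
Local Notation slope := (slope_poly v lam).
Local Notation tildep := (tilde_poly v lam).

Lemma homogeneous_of_uniq d e a : a != 0 ->
  homogeneous_of d a -> homogeneous_of e a -> d = e.
Proof.
move=> a0 da ea; apply: contraNeq a0 => de.
have := component_homogeneous d da.
by rewrite eqxx (component_homogeneous _ ea) (negPf de) => <-.
Qed.

Lemma slope_neq0 f : slope f -> f != 0.
Proof. by case=> f00 _ _; apply: contraNneq f00 => ->; rewrite coef0. Qed.

Lemma homogeneous_tilde_poly f : slope f ->
  homogeneous_poly_of lam (v f`_0) (tildep f).
Proof.
move=> sf; rewrite tilde_poly_initial_form //.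
by apply: homogeneous_initial_form; case: sf.
Qed.

Lemma tilde_poly_coef0 f : slope f -> (tildep f)`_0 = tilde v f`_0.
Proof.
move=> sf; rewrite tilde_poly_initial_form // coef_initial_form subr0.
by case: sf => f00 _ _; rewrite /tilde (negPf f00).
Qed.

Lemma tilde_poly_neq0 f : slope f -> tildep f != 0.
Proof.
move=> sf; have [f00 _ _] := sf; apply: contraTneq (tilde_neq0 v f00).
by rewrite -tilde_poly_coef0 // => ->; rewrite coef0 eqxx.
Qed.

Lemma tilde_poly_coef_lead f : slope f ->
  (tildep f)`_(size f).-1 = tilde v (lead_coef f).
Proof.
move=> sf; have [f00 lamE df] := sf; rewrite tilde_poly_initial_form //.
rewrite coef_initial_form {1}lamE addrC addKr -lead_coefE.
by rewrite /tilde lead_coef_eq0 (negPf (slope_neq0 sf)).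
Qed.

Lemma size_tilde_poly f : slope f -> size (tildep f) = size f.
Proof.
move=> sf; have szf : (0 < size f)%N by rewrite size_poly_gt0 slope_neq0.
apply/eqP; rewrite eqn_leq size_poly -[size f]prednK // ltnNge.
apply/negP => sz; have := tilde_poly_coef_lead sf; rewrite nth_default //.
by move/esym/eqP; apply/negP; rewrite tilde_neq0 // lead_coef_eq0 slope_neq0.
Qed.

Lemma lead_coef_tilde_poly f : slope f ->
  lead_coef (tildep f) = tilde v (lead_coef f).
Proof. by move=> sf; rewrite lead_coefE size_tilde_poly // tilde_poly_coef_lead.
  Qed.

Lemma slopeC c : c != 0 -> slope c%:P.
Proof.
move=> c0; rewrite /slope_poly lead_coefC size_polyC c0 coefC /= add0r; split=> //.
exact/boundedC/vge_val.
Qed.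

Lemma tilde_polyC c : c != 0 -> tildep c%:P = (tilde v c)%:P.
Proof.
move=> c0; apply/polyP => j; rewrite tilde_poly_initial_form; last exact: slopeC.
rewrite coef_initial_form !coefC eqxx; case: eqP => [->|_]; last by rewrite gclass0.
by rewrite subr0 /tilde (negPf c0).
Qed.

(** Factors of the homogeneous polynomial [1] are homogeneous, and degrees add
    up. *)
Lemma ring_unit_size p : ring_unit p -> size p = 1%N.
Proof.
case=> q pq; have one0 : (1 : {poly graded v}) != 0 := oner_neq0 _.
have hom1 : homogeneous_poly_of lam 0 (1 : {poly graded v}).
  move=> j; rewrite coefC; case: eqP => [->|_].
    by rewrite subr0; exists 1; rewrite ?gclass1 ?vge1.
  by exists 0; rewrite ?gclass0 ?vge0.
rewrite -pq in one0 hom1; have [d [e [_ dp _]]] := homogeneous_factors one0 hom1.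
have p0 : p != 0 by apply: contraNneq one0 => ->; rewrite mul0r.
have q0 : q != 0 by apply: contraNneq one0 => ->; rewrite mulr0.
have := size_homogeneousM dp p0 q0; rewrite pq size_poly1.
move: p0 q0; rewrite -!size_poly_gt0; case: (size p) => // m _.
by case: (size q) => // m' _; rewrite addnS /= => -[/esym/eqP];
  rewrite addn_eq0 => /andP[/eqP->].
Qed.

Hypothesis hens : henselian v.

(** The roots of a factor are among the roots of [f], and initial forms are
    multiplicative. *)
Lemma slope_factor f g h : slope f -> f = g * h ->
  [/\ slope g, slope h & tildep f = tildep g * tildep h].
Proof.
move=> sf fE; have := slope_neq0 sf; rewrite fE mulf_eq0 negb_or => /andP[g0 h0].
have [K [i [w [_ vw]]]] := exists_valued_closure hens.
have sg : slope g.
  apply: (slope_of_roots vw) => // r gr; apply: (slope_root_val vw sf).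
  by rewrite fE rmorphM rootM gr.
have sh : slope h.
  apply: (slope_of_roots vw) => // r hr; apply: (slope_root_val vw sf).
  by rewrite fE rmorphM rootM hr orbT.
split=> //; rewrite !tilde_poly_initial_form //.
  have [g00 _ dg] := sg; have [h00 _ dh] := sh.
  by rewrite -initial_formM // coefM big_ord1 valuationM.
by rewrite -fE.
Qed.

(** If the prime [k] does not divide [q], the whole power [k ^ s] goes to [p].
    *)
Lemma homogeneous_prime_power_divides k s p q c :
  k \is monic -> homogeneous_prime lam k -> ~ ring_divides k q ->
  (exists d, homogeneous_poly_of lam d p) ->
  (exists d, homogeneous_poly_of lam d q) -> p != 0 ->
  p * q = k ^+ s * c -> exists p', p = k ^+ s * p' /\ p' * q = c.
Proof.
move=> mon_k prime_k kq [d dp] [e eq]; elim: s d p dp => [|s IHs] d p dp p0.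
  by rewrite mul1r => pq; exists p; rewrite mul1r.
rewrite exprS -mulrA => pq.
have [|[p1 pE]|//] := prime_k _ _ _ _ dp eq; first by exists (k ^+ s * c).
rewrite pE in p0 dp; have [_ [d1 [_ _ dp1]]] := homogeneous_factors p0 dp.
have p10 : p1 != 0 by apply: contraNneq p0 => ->; rewrite mulr0.
have [|p' [p1E p'q]] := IHs _ _ dp1 p10.
  by apply: (monic_mulI mon_k); rewrite -pq pE mulrA.
by exists p'; rewrite pE p1E mulrA.
Qed.

(** Induction on the degree. A monic irreducible factor [p1] of [f] contributes
    a power of a prime [k] to the initial form; as [p] and [q] are coprime,
    this power divides one of them, and [p1] is put in the corresponding lift.
    *)
Lemma slope_hensel f p q : slope f -> tildep f = p * q -> ring_coprime p q ->
  exists g h, [/\ slope g, slope h, f = g * h, tildep g = p & tildep h = q].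
Proof.
have [n] := ubnP (size f); elim: n f p q => // n IHn f p q fn sf fE co_pq.
have f0 := slope_neq0 sf.
have nz := tilde_poly_neq0 sf; have hom := homogeneous_tilde_poly sf.
rewrite fE in nz hom; have [d [e [_ dp eq]]] := homogeneous_factors nz hom.
have p0 : p != 0 by apply: contraNneq nz => ->; rewrite mul0r.
have q0 : q != 0 by apply: contraNneq nz => ->; rewrite mulr0.
have [sz_f|sz_f] := leqP (size f) 1.
  have /size_poly1P[c c0 fc] : size f == 1%N by rewrite eqn_leq sz_f size_poly_gt0.
  have tc : tilde v c != 0 := tilde_neq0 v c0.
  have [sz_p sz_q] : size p = 1%N /\ size q = 1%N.
    have := size_homogeneousM dp p0 q0;
      rewrite -fE size_tilde_poly // fc size_polyC c0.
    move: p0 q0; rewrite -!size_poly_gt0; case: (size p) => // m _.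
    by case: (size q) => // m' _; rewrite addnS /= => -[/esym/eqP];
      rewrite addn_eq0 => /andP[/eqP-> /eqP->].
  have [a a0 pE] : exists2 a, a != 0 & p = a%:P by apply/size_poly1P/eqP.
  have [b b0 qE] : exists2 b, b != 0 & q = b%:P by apply/size_poly1P/eqP.
  have [|x [x0 _ aE]] := homogeneous_neq0 (_ : homogeneous_of d a) a0.
    by have := dp 0; rewrite pE coefC subr0.
  have cx0 : c / x != 0 by rewrite mulf_neq0 ?invr_eq0.
  have bE : tilde v (c / x) = b.
    have : tilde v c = tilde v x * b.
      by apply: polyC_inj; rewrite polyCM -aE -pE -qE -fE fc tilde_polyC.
    by rewrite -tildeM => ->; rewrite mulrAC tildeM mulfV // tilde1 mul1r.
  exists x%:P, (c / x)%:P; rewrite !tilde_polyC // bE -aE pE qE -polyCM; split=> //.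
  - exact: slopeC.
  - exact: slopeC.
  - by rewrite mulrC divfK.
have [q1 [r [f_qr irr_q1]]] := exists_irreducible_factor sz_f.
have c0 : lead_coef q1 != 0.
  by rewrite lead_coef_eq0; case: irr_q1 => q11 _; rewrite -size_poly_gt0 ltnW.
pose p1 := (lead_coef q1)^-1 *: q1; pose f2 := lead_coef q1 *: r.
have mon_p1 : p1 \is monic by rewrite monicE lead_coefZ mulVf.
have irr_p1 : irreducible_poly p1 by apply: irreducible_polyZ; rewrite ?invr_eq0.
have f_pf : f = p1 * f2.
  by rewrite /p1 /f2 -scalerAr -scalerAl scalerA mulfV // scale1r.
have [sp1 sf2 tfE] := slope_factor sf f_pf.
have [k [s [[irr_k mon_k hom_k s0 tp1] prime_k]]] :=
  irreducible_initial_form hens mon_p1 irr_p1 sp1.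
rewrite -tilde_poly_initial_form // in tp1.
have f2n : (size f2 < n)%N.
  rewrite -ltnS (leq_trans _ fn) // ltnS f_pf size_monicM ?slope_neq0 //.
  by case: irr_p1; case: (size p1) => // -[|m] // _ _;
    rewrite !addSn /= ltnS leq_addl.
(* The case where k divides the first factor; the other one is symmetric. *)
have split_off (p' q' : {poly graded v}) d' e' : homogeneous_poly_of lam d' p' ->
    homogeneous_poly_of lam e' q' -> p' != 0 -> tildep f = p' * q' ->
    ring_coprime p' q' -> ring_divides k p' ->
    exists g h, [/\ slope g, slope h, f = g * h, tildep g = p' & tildep h = q'].
  move=> dp' eq' p'0 fE' co kp'.
  have kq' : ~ ring_divides k q' by move=> kq'; have [_ nu _] := irr_k; apply/nu/co.
  have [||||p'' [p'E p''q']] :=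
    @homogeneous_prime_power_divides k s p' q' (tildep f2) mon_k prime_k kq'.
  - by exists d'.
  - by exists e'.
  - by [].
  - by rewrite -fE' tfE tp1.
  have [|g' [h [sg' sh f2E g'E hE]]] := IHn f2 p'' q' f2n sf2 (esym p''q').
    move=> c [c' cE] cq'; apply: co => //.
    by exists (k ^+ s * c'); rewrite p'E cE mulrCA.
  have f_gh : f = (p1 * g') * h by rewrite f_pf f2E mulrA.
  have [sg _ _] := slope_factor sf f_gh.
  exists (p1 * g'), h; split=> //.
  by have [_ _ ->] := slope_factor sg erefl; rewrite tp1 g'E p'E.
have [|kp|kq] := prime_k _ _ _ _ dp eq.
- rewrite -fE tfE tp1; exists (k ^+ s.-1 * tildep f2).
  by rewrite mulrA -exprS prednK.
- exact: (split_off p q d e).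
- have [|g [h [sg sh fgh gE hE]]] :=
  split_off q p e d eq dp q0 _ (ring_coprime_sym co_pq) kq.
    by rewrite mulrC.
  by exists h, g; split=> //; rewrite mulrC.
Qed.

End SlopeTilde.

(** * Irreducibility, simple roots and homogenizable lifts *)

Section Hensel.
Variables (D : oagType) (E : fieldType) (v : valuation D E) (lam : D).
Hypothesis hens : henselian v.
Implicit Types f g h : {poly E}.
Local Notation slope := (slope_poly v lam).
Local Notation tildep := (tilde_poly v lam).

Lemma irreducible_of_tilde f : slope f -> (1 < size f)%N ->
  ring_irreducible (tildep f) -> irreducible_poly f.
Proof.
move=> sf f1 [_ _ irr]; split=> // g g1 gf.
have /dvdpP[h fE] := gf; have [sh sg tfE] := slope_factor hens sf fE.
have [uh|ug] := irr _ _ tfE; last first.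
  by case/eqP: g1; rewrite -(size_tilde_poly sg) (ring_unit_size lam ug).
rewrite -dvdp_size_eqp // fE size_mul ?(slope_neq0 sg) ?(slope_neq0 sh) //.
by rewrite -(size_tilde_poly sh) (ring_unit_size lam uh).
Qed.

Lemma irreducible_tilde_power f : irreducible_poly f -> slope f ->
  exists (k : {poly graded v}) s,
    [/\ ring_irreducible k, k \is monic, homogenizable lam k, (0 < s)%N &
        tildep f = (tilde v (lead_coef f))%:P * k ^+ s].
Proof.
move=> irr_f sf; have f0 := slope_neq0 sf.
have c0 : lead_coef f != 0 by rewrite lead_coef_eq0.
pose p := (lead_coef f)^-1 *: f.
have fE : f = (lead_coef f)%:P * p by rewrite mul_polyC scalerA mulfV // scale1r.
have mon_p : p \is monic by rewrite monicE lead_coefZ mulVf.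
have irr_p : irreducible_poly p by apply: irreducible_polyZ; rewrite ?invr_eq0.
have [_ sp tfE] := slope_factor hens sf fE.
have [k [s [[irr_k mon_k hom_k s0 tpE] _]]] :=
  irreducible_initial_form hens mon_p irr_p sp.
exists k, s; split=> //.
by rewrite tfE tilde_polyC // -tpE tilde_poly_initial_form.
Qed.

(** A common divisor is homogeneous, as a factor of ['X - b]; it is either a
    unit or an associate of ['X - b], in which case [b] would be a root of [q].
    *)
Lemma ring_coprime_XsubC f (q : {poly graded v}) b : slope f ->
  tildep f = ('X - b%:P) * q -> ~~ root q b -> ring_coprime ('X - b%:P) q.
Proof.
move=> sf fE qb d [c XbE] [c' qE].
have Xb0 : 'X - b%:P != 0 :> {poly graded v} := monic_neq0 (monicXsubC b).
have nz := tilde_poly_neq0 sf; have hom := homogeneous_tilde_poly sf.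
rewrite fE in nz hom; have [g [_ [_ hom_Xb _]]] := homogeneous_factors nz hom.
rewrite XbE in Xb0 hom_Xb;
  have [g1 [g2 [_ hom_d hom_c]]] := homogeneous_factors Xb0 hom_Xb.
have d0 : d != 0 by apply: contraNneq Xb0 => ->; rewrite mul0r.
have c0 : c != 0 by apply: contraNneq Xb0 => ->; rewrite mulr0.
have sz := size_homogeneousM hom_d d0 c0; rewrite -XbE size_XsubC in sz.
have homC (r : {poly graded v}) (e : D) : homogeneous_poly_of lam e r -> r != 0 ->
    size r = 1%N -> ring_unit r.
  move=> hom_r r0 /eqP/size_poly1P[a a0 rE].
  have [|y ay] := homogeneous_unit (_ : homogeneous_of e a) a0.
    by have := hom_r 0; rewrite rE coefC subr0.
  by exists y%:P; rewrite rE -polyCM ay.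
have [d1|d1] := leqP (size d) 1.
  by apply: (homC d g1) => //; apply/eqP; rewrite eqn_leq d1 size_poly_gt0.
have [|e ce] := homC c g2 hom_c c0.
  move/eqP: sz d1 c0; rewrite -size_poly_gt0.
  by case: (size d) => [|[|[|[|m]]]]; case: (size c) => [|[|[|m']]].
case/negP: qb; have -> : q = ('X - b%:P) * (e * c').
  by rewrite qE XbE -mulrA (mulrA c) ce mul1r.
by rewrite /root hornerM hornerXsubC subrr mul0r.
Qed.

(** The coprime factorization [('X - b) q] lifts to [f = g h] with [g] of
    degree one. Its root [a] is not a root of [h], for ['X - b] would then
    divide the initial form [q] of [h]. *)
Lemma simple_root_lift f b : slope f -> simple_root (tildep f) b ->
  exists2 a, simple_root f a & tilde v a = b.
Proof.
move=> sf [q fE qb]; rewrite mulrC in fE.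
have co := ring_coprime_XsubC sf fE qb.
have [g [h [sg sh f_gh gE hE]]] := slope_hensel hens sf fE co.
have sz_g : size g = 2%N by rewrite -(size_tilde_poly sg) gE size_XsubC.
have g1 : g`_1 != 0 by have := lead_coefE g; rewrite sz_g => <-;
  rewrite lead_coef_eq0 (slope_neq0 sg).
have tg1 : tilde v g`_1 = 1.
  have := lead_coef_tilde_poly sg; rewrite gE lead_coefXsubC => ->.
  by rewrite lead_coefE sz_g.
have tg0 : tilde v g`_0 = - b.
  by rewrite -(tilde_poly_coef0 sg) gE coefB coefX coefC sub0r.
pose a := - g`_0 / g`_1.
have gP : g = (g`_1)%:P * ('X - a%:P).
  apply/polyP => -[|[|j]]; rewrite coefCM coefB coefX coefC /=.
  - by rewrite sub0r /a mulNr opprK mulrCA mulfV ?mulr1.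
  - by rewrite subr0 mulr1.
  - by rewrite subr0 mulr0 nth_default // sz_g.
have ta : tilde v a = b.
  by rewrite -[LHS]mulr1 -tg1 tildeM /a divfK // tildeN tg0 opprK.
exists a => //; exists (h * (g`_1)%:P); first by rewrite f_gh {1}gP mulrC mulrA.
rewrite rootM rootC negb_or g1 andbT; apply: contraNN qb => /factor_theorem[h' h'E].
have [_ _ thE] := slope_factor hens sh h'E.
have [_ _ tgE] := slope_factor hens sg gP.
rewrite tilde_polyC // tg1 mul1r gE in tgE.
by rewrite /root -hE thE -tgE hornerM hornerXsubC subrr mulr0.
Qed.

(** A nonzero [tilde v f`_j] is homogeneous of a single grade, the value of
    [f`_j], so homogeneity puts all nonzero coefficients on the line. *)
Lemma slope_of_homogenizable f : f`_0 != 0 ->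
  homogenizable lam (map_poly (tilde v) f) ->
  slope f /\ tildep f = map_poly (tilde v) f.
Proof.
move=> f00 [d hom_f].
have tilde0 : tilde v 0 = 0 by rewrite /tilde eqxx.
have vf j : f`_j != 0 -> v f`_j = d - lam *+ j.
  move=> fj0; apply: homogeneous_of_uniq (tilde_neq0 v fj0) _ _.
    by rewrite /tilde (negPf fj0); exists f`_j; rewrite ?vge_val.
  by have := hom_f j; rewrite coef_map_id0.
have f0 : f != 0 by apply: contraNneq f00 => ->; rewrite coef0.
have vf0 : v f`_0 = d by rewrite vf // subr0.
have sf : slope f.
  have lead0 : f`_(size f).-1 != 0 by rewrite -lead_coefE lead_coef_eq0.
  split; first exact: f00.
    by rewrite vf0 lead_coefE (vf _ lead0) addrC subrK.
  move=> j; rewrite vf0; have [->|fj0] := eqVneq f`_j 0; first exact: vge0.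
  by rewrite -vf // vge_val.
split=> //; apply/polyP => j; rewrite tilde_poly_initial_form // coef_initial_form.
rewrite coef_map_id0 // vf0; have [->|fj0] := eqVneq f`_j 0.
  by rewrite gclass0 tilde0.
by rewrite -vf // /tilde (negPf fj0).
Qed.

End Hensel.

Theorem theorem1p9 (D : oagType) (E : fieldType) (v : valuation D E)
    (hull : divisible_hull v) (hens : henselian v)
    (n : nat) (n_gt0 : (0 < n)%N)
    (f : {poly E}) (sz_f : size f = n.+1) (f0 : f`_0 != 0) (lam : D) :
  [/\
    (* (1) *)
    lambda_poly v lam f ->
      (forall g h : {poly E}, f = g * h ->
        [/\ lambda_poly v lam g, lambda_poly v lam h &
            tilde_poly v lam f = tilde_poly v lam g * tilde_poly v lam h]) /\
      (ring_irreducible (tilde_poly v lam f) -> irreducible_poly f),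
    (* (2) *)
    irreducible_poly f -> lam *+ n = v f`_0 - v f`_n ->
      lambda_poly v lam f /\
      exists (k : {poly graded v}) (s : nat),
        [/\ ring_irreducible k, k \is monic, homogenizable lam k, (0 < s)%N &
            tilde_poly v lam f = (tilde v f`_n)%:P * k ^+ s],
    (* (3) *)
    lambda_poly v lam f ->
      forall l m : {poly graded v},
        tilde_poly v lam f = l * m -> ring_coprime l m ->
        exists g h : {poly E},
          [/\ lambda_poly v lam g /\ lambda_poly v lam h, f = g * h,
              tilde_poly v lam g = l & tilde_poly v lam h = m],
    (* (4) *)
    lambda_poly v lam f ->
      forall b : graded v, simple_root (tilde_poly v lam f) b ->
        exists2 a : E, simple_root f a & tilde v a = b
    &
    (* (5) *)
    homogenizable lam (map_poly (tilde v) f) ->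
      lambda_poly v lam f /\ tilde_poly v lam f = map_poly (tilde v) f ].
Proof.
have lamP g : lambda_poly v lam g <-> slope_poly v lam g := lambda_polyP hens lam g.
have fn : f`_n = lead_coef f by rewrite lead_coefE sz_f.
split.
- move=> /lamP sf; split=> [g h fE|]; last by apply: irreducible_of_tilde;
  rewrite ?sz_f.
  by have [/lamP ? /lamP ?] := slope_factor hens sf fE.
- move=> irr_f lamE; rewrite fn in lamE *.
  have lf : lambda_poly v lam f by apply: irreducible_slope; rewrite ?sz_f.
  by split=> //; apply: irreducible_tilde_power => //; apply/lamP.
- move=> /lamP sf l m fE co;
  have [g [h [/lamP ? /lamP ? ? ? ?]]] := slope_hensel hens sf fE co.
  by exists g, h.
- by move=> /lamP sf b; apply: simple_root_lift.
- by move=> /(slope_of_homogenizable f0)[/lamP].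
Qed.
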